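(* For every integer $n\geq 1$ there exists a continuum $Y$ (compact connected metric space) of topological dimension $n$ and a homeomorphism $S\colon Y\to Y$ which is transitive and completely scrambled.
   Context: Let $(X,d)$ be a compact metric space and $T\colon X\to X$ continuous. A pair $x,y\in X$ is proximal if $\liminf_{n\to\infty} d(T^n(x),T^n(y))=0$, asymptotic if $\limsup_{n\to\infty} d(T^n(x),T^n(y))=0$, and Li-Yorke if it is proximal but not asymptotic. $(X,T)$ is completely scrambled if every pair of distinct points is a Li-Yorke pair. $(X,T)$ is transitive if for any nonempty open $U,V$ there is $n>0$ with $T^n(U)\cap V\neq\emptyset$. Dimension means topological (covering) dimension. *)

(* Defs.v *)
From Stdlib Require Import Reals List Arith.
Open Scope R_scope.

Section Metric.
Variable X : Type.
Variable d : X -> X -> R.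

Definition is_metric : Prop :=
  (forall x y, 0 <= d x y) /\
  (forall x y, d x y = 0 <-> x = y) /\
  (forall x y, d x y = d y x) /\
  (forall x y z, d x z <= d x y + d y z).

Definition open_set (U : X -> Prop) : Prop :=
  forall x, U x -> exists eps, 0 < eps /\ forall y, d x y < eps -> U y.

Definition compact_space : Prop :=
  forall F : (X -> Prop) -> Prop,
    (forall U, F U -> open_set U) ->
    (forall x, exists U, F U /\ U x) ->
    exists l : list (X -> Prop),
      (forall U, In U l -> F U) /\ (forall x, exists U, In U l /\ U x).

Definition connected_space : Prop :=
  ~ exists U V : X -> Prop,
      open_set U /\ open_set V /\ (exists x, U x) /\ (exists y, V y) /\
      (forall x, U x \/ V x) /\ (forall x, ~ (U x /\ V x)).

Definition continuum : Prop :=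
  is_metric /\ inhabited X /\ compact_space /\ connected_space.

(* Lebesgue covering dimension.  A finite family of subsets indexed by
   0 .. m-1 is given as a function nat -> (X -> Prop) with size m. *)
Definition finite_open_cover (m : nat) (U : nat -> X -> Prop) : Prop :=
  (forall i, (i < m)%nat -> open_set (U i)) /\
  (forall x, exists i, (i < m)%nat /\ U i x).

Definition refines (k : nat) (V : nat -> X -> Prop) (m : nat) (U : nat -> X -> Prop) : Prop :=
  forall j, (j < k)%nat -> exists i, (i < m)%nat /\ forall x, V j x -> U i x.

Definition order_le (k : nat) (V : nat -> X -> Prop) (n : nat) : Prop :=
  forall x (l : list nat), NoDup l ->
    (forall j, In j l -> (j < k)%nat /\ V j x) -> (length l <= n + 1)%nat.

Definition covering_dim_le (n : nat) : Prop :=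
  forall m U, finite_open_cover m U ->
    exists k V, finite_open_cover k V /\ refines k V m U /\ order_le k V n.

(* dim X = n for n >= 1 : dim X <= n and not dim X <= n - 1 *)
Definition covering_dim_eq (n : nat) : Prop :=
  covering_dim_le n /\ ~ covering_dim_le (n - 1).

Definition continuous_map (T : X -> X) : Prop :=
  forall x eps, 0 < eps -> exists delta, 0 < delta /\
    forall y, d x y < delta -> d (T x) (T y) < eps.

Definition homeomorphism (T : X -> X) : Prop :=
  continuous_map T /\
  exists Tinv : X -> X, continuous_map Tinv /\
    (forall x, Tinv (T x) = x) /\ (forall x, T (Tinv x) = x).

Fixpoint iter_map (T : X -> X) (n : nat) (x : X) : X :=
  match n with O => x | S k => T (iter_map T k x) end.

Definition transitive_map (T : X -> X) : Prop :=
  forall U V : X -> Prop, open_set U -> open_set V ->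
    (exists x, U x) -> (exists y, V y) ->
    exists n, (0 < n)%nat /\ exists x, U x /\ V (iter_map T n x).

(* liminf_{n} d(T^n x, T^n y) = 0 (the sequence is nonnegative) *)
Definition proximal (T : X -> X) (x y : X) : Prop :=
  forall eps, 0 < eps -> forall N, exists n, (N <= n)%nat /\
    d (iter_map T n x) (iter_map T n y) < eps.

Definition asymptotic (T : X -> X) (x y : X) : Prop :=
  forall eps, 0 < eps -> exists N, forall n, (N <= n)%nat ->
    d (iter_map T n x) (iter_map T n y) < eps.

Definition li_yorke_pair (T : X -> X) (x y : X) : Prop :=
  proximal T x y /\ ~ asymptotic T x y.

Definition completely_scrambled (T : X -> X) : Prop :=
  forall x y, x <> y -> li_yorke_pair T x y.

End Metric.

(* Main.v *)
(* The space is the closure, under the shift, of the orbit of a single sequence f : Z -> [0,1]^n.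
   Expand t in a mixed radix system with signed digits (radix 8(k+1) at level k); the r-th coordinate
   of f t is the product over k of slowly varying tent functions of the k-th digit, equal to 1 at digit 0
   and vanishing well before the extreme digits.
   - f is a string of copies, centred at the multiples of the k-th period p_k, of one central block, with
     amplitudes changing by at most 1/(k+1) from one copy to the next: so |f(t + p_k) - f t| <= 1/(k+1)
     (uniform rigidity), whence no two distinct points are asymptotic and the shift is transitive.
   - The blocks are separated by long gaps where f = 0, which occur syndetically: so every pair is
     proximal.
   - At level k the coordinate r = k mod n decreases to 0 before the other ones start to decrease. Hence
     every single coordinate of f may be multiplied by any c in [0,1] within the orbit closure, which is
     therefore star-shaped about 0 (connected) and contains the n-cube of all (c_1 f_1, ..., c_n f_n).
   - A window of bounded length meets at most one copy of a large block, so that each coordinate of the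
     orbit closure projects to a finite union of rays. Cutting such a star at n + 1 disjoint lattices gives
     n + 1 colours, every point being missed by at most one of them in each coordinate; with n coordinates
     some colour catches the point in all of them, so the dimension is at most n (Ostrand).
   - The cube and Kuhn's cubical form of Sperner's lemma show that the dimension is at least n. *)
Require Import Defs.
From Stdlib Require Import Reals List Arith.
From Stdlib Require Import ZArith Lia Lra Psatz.
From Stdlib Require Import Classical IndefiniteDescription ClassicalEpsilon.
From Stdlib Require Import ProofIrrelevance FunctionalExtensionality PropExtensionality.
From mathcomp Require all_boot all_fingroup all_algebra.
Open Scope R_scope.

(** * Kuhn's cubical Sperner lemma *)

Module Kuhn.
Set Implicit Arguments. Unset Strict Implicit. Unset Printing Implicit Defensive.
Import all_boot all_fingroup all_algebra.
Import GRing.Theory.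
Local Open Scope ring_scope.

Lemma F2_addrr (x : 'F_2) : x + x = 0.
Proof. by apply: addrr_pchar2; apply: pchar_Fp. Qed.

Lemma leq_addb (m k : nat) (b : bool) : (m <= k)%N -> (m + b <= k.+1)%N.
Proof. by move=> h; rewrite -[k.+1]addn1 leq_add // leq_b1. Qed.

(** A parity indicator: over ['F_2] it is 1 exactly when [l] permutes the labels below [n], because
    otherwise some column vanishes. *)
Definition label_det (n : nat) (l : nat -> nat) : 'F_2 :=
  \det (\matrix_(k < n, c < n) (l k == c)%:R).

Lemma eq_label_det n (l l' : nat -> nat) :
  (forall k, (k < n)%N -> l k = l' k) -> label_det n l = label_det n l'.
Proof.
by move=> H; congr (\det _); apply/matrixP => i j; rewrite !mxE H.
Qed.

Lemma label_det_missing n (l : nat -> nat) (c : nat) :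
  (c < n)%N -> (forall k, (k < n)%N -> l k <> c) -> label_det n l = 0.
Proof.
move=> cn H; rewrite /label_det (expand_det_col _ (Ordinal cn)) big1 // => i _.
by rewrite mxE; case: eqP => [/(H _ (ltn_ord i))//|_]; rewrite mul0r.
Qed.

(* Every row of the label matrix sums to 1, so its last column may be replaced by ones. *)
Lemma label_det_expand n (l : nat -> nat) :
  (forall k, (k < n.+1)%N -> (l k <= n)%N) ->
  label_det n.+1 l = \sum_(i < n.+1) label_det n (fun k => l (bump i k)).
Proof.
move=> H.
pose A : 'M['F_2]_n.+1 := \matrix_(k, c) (l k == c)%:R.
pose U : 'M['F_2]_n.+1 := \matrix_(c', c) ((c' == c) || (c == ord_max))%:R.
have detU : \det U = 1.
  rewrite -det_tr det_trig.
    by apply: big1 => i _; rewrite !mxE eqxx.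
  apply/is_trig_mxP => i j lij; rewrite !mxE.
  have -> : (j == i) = false by apply/eqP => e; rewrite e ltnn in lij.
  have -> // : (i == ord_max) = false.
  by apply/eqP => e; have := ltn_ord j; rewrite ltnS leqNgt; rewrite e /= in lij; rewrite lij.
have AU k c : (A *m U) k c = if c == ord_max then 1 else A k c.
  rewrite mxE; case: ifP => cm.
    have lk : (l k < n.+1)%N by rewrite ltnS H.
    rewrite (bigD1 (Ordinal lk)) //= big1 => [|i ni].
      by rewrite !mxE cm orbT eqxx mulr1 addr0.
    rewrite mxE; case: eqP => [e|_]; last by rewrite mul0r.
    by case/eqP: ni; apply: val_inj.
  rewrite (bigD1 c) //= big1 => [|i ni]; first by rewrite !mxE eqxx cm mulr1 addr0.
  by rewrite [U _ _]mxE (negPf ni) cm mulr0.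
have -> : label_det n.+1 l = \det (A *m U) by rewrite det_mulmx detU mulr1.
rewrite (expand_det_col _ ord_max); apply: eq_bigr => i _.
rewrite AU eqxx mul1r /cofactor.
have -> : (-1 : 'F_2) = 1 by apply/eqP; rewrite -subr_eq0 -opprD F2_addrr oppr0.
rewrite expr1n mul1r; congr (\det _); apply/matrixP => k c.
rewrite [RHS]mxE 2!mxE AU.
have -> : (lift ord_max c == ord_max) = false by apply/negbTE; rewrite eq_sym neq_lift.
by rewrite mxE (_ : (lift ord_max c : nat) = c) //; exact: lift_max.
Qed.

(** Extension by zeros places the grids of all dimensions in one type, so a single labelling [lab]
    also labels the face where the last coordinate is 0. *)
Definition point n (u : 'I_n -> nat) : nat -> nat :=
  fun r => if insub r is Some i then u i else 0%N.

Lemma eq_point n (u u' : 'I_n -> nat) : u =1 u' -> point u = point u'.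
Proof.
move=> e; apply: FunctionalExtensionality.functional_extensionality => r.
by rewrite /point; case: insubP => // i _ _; rewrite e.
Qed.

(* The vertices of the Freudenthal simplex at [u] with ordering [s]. *)
Definition vtx n (s : 'S_n) (u : 'I_n -> nat) (k : nat) : nat -> nat :=
  point (fun i => (u i + (s i < k))%N).

Definition simplex_sum n N (lab : (nat -> nat) -> nat) : 'F_2 :=
  \sum_(s : 'S_n) \sum_(v : {ffun 'I_n -> 'I_N.+1})
    label_det n.+1 (fun k => lab (vtx s (fun i => v i) k)).

Definition proper n N (lab : (nat -> nat) -> nat) : Prop :=
  forall u : 'I_n -> nat, (forall i, (u i <= N.+1)%N) ->
    (lab (point u) <= n)%N /\
    (forall i, u i = 0%N -> (lab (point u) <= i)%N) /\
    (forall i, u i = N.+1 -> lab (point u) <> i).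

(** * Cancellation of facets modulo 2 *)

Lemma sum_perm_tperm n (i j : 'I_n) (F : 'S_n -> 'F_2) : i != j ->
  (forall s, F (s * tperm i j)%g = F s) -> \sum_s F s = 0.
Proof.
move=> ij H; rewrite (bigID (@odd_perm _)) /=.
rewrite (reindex_inj (mulIg (tperm i j))) /=.
under eq_bigr do rewrite H.
rewrite (eq_bigl (fun s => ~~ odd_perm s)); first exact: F2_addrr.
by move=> s; rewrite odd_permM odd_tperm ij addbT.
Qed.

Section Step.
Variables (n N : nat) (lab : (nat -> nat) -> nat).
Hypothesis Hp : proper n.+1 N lab.

Let G (s : 'S_n.+1) (u : 'I_n.+1 -> nat) := label_det n.+1 (fun k => lab (vtx s u k)).

(** The facet opposite an inner vertex [i] is shared with the simplex whose ordering exchanges the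
    positions [i - 1] and [i]: the two paths of vertices differ at vertex [i] only. *)
Lemma inner_facets_cancel (i : nat) : (0 < i < n.+1)%N ->
  \sum_(s : 'S_n.+1) \sum_(v : {ffun 'I_n.+1 -> 'I_N.+1})
    label_det n.+1 (fun k => lab (vtx s (fun i => v i) (bump i k))) = 0.
Proof.
case/andP => i0 i1.
have i1' : (i.-1 < n.+1)%N by rewrite (leq_ltn_trans (leq_pred _)).
apply: (@sum_perm_tperm _ (Ordinal i1') (Ordinal i1)).
  by rewrite -val_eqE /= -{2}(prednK i0) neq_ltn ltnSn.
move=> s; apply: eq_bigr => v _; apply: eq_label_det => k kn; congr lab.
apply: eq_point => r; congr (_ + nat_of_bool _)%N.
rewrite permM; have ib : i != bump i k by exact: neq_bump.
case: tpermP => [->|->|//] /=.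
  apply/idP/idP => h; first by rewrite (leq_ltn_trans _ h) ?leq_pred.
  by rewrite ltn_neqAle ib -{1}(prednK i0).
apply/idP/idP => h; last by rewrite (leq_ltn_trans _ h) ?leq_pred.
by rewrite ltn_neqAle ib -{1}(prednK i0).
Qed.

(** The cycle that lowers every position by one and sends 0 to the top. *)
Definition rot_perm_fun (x : 'I_n.+1) : 'I_n.+1 :=
  if unlift ord0 x is Some j then widen_ord (leqnSn n) j else ord_max.

Lemma rot_perm_inj : injective rot_perm_fun.
Proof.
move=> x y; rewrite /rot_perm_fun.
case: (unliftP ord0 x) => [j|] ->; case: (unliftP ord0 y) => [k|] -> //.
- by move=> /(congr1 val) /= e; congr lift; apply: val_inj.
- by move=> /(congr1 val) /= e; have := ltn_ord j; rewrite e ltnn.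
- by move=> /(congr1 val) /= e; have := ltn_ord k; rewrite -e ltnn.
Qed.

Definition rot_perm : 'S_n.+1 := perm rot_perm_inj.

(** Without its first vertex a simplex starts one step further in the direction that was incremented
    first. Making this direction the last one shows the same facet as opposite the last vertex of
    another simplex. *)
Lemma first_facet (s : 'S_n.+1) (u : 'I_n.+1 -> nat) :
  label_det n.+1 (fun k => lab (vtx s u k.+1)) =
  G (s * rot_perm)%g (fun r => (u r + ((s * rot_perm)%g r == ord_max))%N).
Proof.
apply: eq_label_det => k kn; congr lab; apply: eq_point => r.
rewrite permM permE /rot_perm_fun -addnA; congr (_ + _)%N.
case: (unliftP ord0 (s r)) => [j|] -> /=; last by rewrite eqxx ltnNge -ltnS kn.
rewrite /bump /= add1n ltnS -val_eqE /=.
by rewrite [in RHS]ltn_eqF.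
Qed.

(** Direction [r] comes last, so the facet opposite the last vertex stays in the face [u r = N.+1],
    where label [r] is forbidden. *)
Lemma upper_face (s : 'S_n.+1) (u : 'I_n.+1 -> nat) (r : 'I_n.+1) :
  (forall i, (u i <= N.+1)%N) -> (forall i, i != r -> (u i <= N)%N) -> s r = ord_max ->
  u r = N.+1 -> G s u = 0.
Proof.
move=> uN uN' sr ur; apply: (@label_det_missing _ _ r) => // k kn.
have nk : (n < k)%N = false by rewrite ltnNge -ltnS kn.
have [] := Hp (u := fun i => (u i + (s i < k))%N).
  move=> i; case: (eqVneq i r) => [->|ir].
    by rewrite sr /= nk addn0 ur.
  by apply: leq_addb; exact: uN'.
by move=> _ [_ H]; apply: H; rewrite sr /= nk addn0.
Qed.

(** On the face [u r = 0] labels are at most [r < n], so label [n] is missing. *)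
Lemma lower_face (s : 'S_n.+1) (u : 'I_n.+1 -> nat) (r : 'I_n.+1) :
  (forall i, (u i <= N)%N) -> s r = ord_max -> r != ord_max ->
  u r = 0%N -> G s u = 0.
Proof.
move=> uN sr rm ur; apply: (@label_det_missing _ _ n) => // k kn.
have nk : (n < k)%N = false by rewrite ltnNge -ltnS kn.
have [] := Hp (u := fun i => (u i + (s i < k))%N).
  by move=> i; apply: leq_addb; exact: uN.
move=> _ [H _]; have := H r; rewrite -/(vtx s u k) sr /= nk addn0 => /(_ ur) h e.
case/eqP: rm; apply: val_inj => /=; apply/eqP; rewrite eqn_leq -ltnS ltn_ord /=.
by rewrite -[X in (X <= _)%N]e.
Qed.

(** A facet orthogonal to direction [r] that lies between two cells is counted from both sides and
    cancels. The top face contributes nothing by [upper_face]; the bottom face remains. *)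
Lemma telescope (s : 'S_n.+1) (r : 'I_n.+1) : s r = ord_max ->
  \sum_(v : {ffun 'I_n.+1 -> 'I_N.+1}) G s (fun i => (v i + (i == r))%N) +
  \sum_(v : {ffun 'I_n.+1 -> 'I_N.+1}) G s (fun i => v i) =
  \sum_(v : {ffun 'I_n.+1 -> 'I_N.+1} | v r == ord0) G s (fun i => v i).
Proof.
move=> sr.
rewrite (bigID (fun v : {ffun 'I_n.+1 -> 'I_N.+1} => v r == ord_max)) /=.
rewrite big1 ?add0r => [|v /eqP vr]; last first.
  apply: (@upper_face _ _ r) => //=.
  - by move=> i; apply: leq_addb; rewrite -ltnS.
  - by move=> i ir; rewrite (negPf ir) addn0 -ltnS.
  - by rewrite vr eqxx /= addn1.
pose up (v : {ffun 'I_n.+1 -> 'I_N.+1}) : {ffun 'I_n.+1 -> 'I_N.+1} :=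
  [ffun i => if i == r then inord (v i).+1 else v i].
pose dn (v : {ffun 'I_n.+1 -> 'I_N.+1}) : {ffun 'I_n.+1 -> 'I_N.+1} :=
  [ffun i => if i == r then inord (v i).-1 else v i].
have upr (v : {ffun 'I_n.+1 -> 'I_N.+1}) : v r != ord_max -> (inord (v r).+1 : 'I_N.+1) = (v r).+1 :> nat.
  move=> vm; have vN : (v r <= N)%N by rewrite -ltnS.
  rewrite inordK // ltnS ltn_neqAle vN andbT.
  by apply: contra vm => /eqP e; apply/eqP/val_inj.
have -> : \sum_(v : {ffun 'I_n.+1 -> 'I_N.+1} | v r != ord_max)
    G s (fun i => (v i + (i == r))%N) =
  \sum_(v : {ffun 'I_n.+1 -> 'I_N.+1} | v r != ord0) G s (fun i => v i).
  rewrite [RHS](reindex_onto up dn) /=; last first.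
    move=> v vr; apply/ffunP => i; rewrite !ffunE; case: eqP => // ->.
    have v0 : (0 < v r)%N by rewrite lt0n.
    apply: val_inj; rewrite /= (inordK (m := (v r).-1)) ?prednK ?inord_val //.
    by rewrite (leq_trans _ (ltn_ord (v r))) // ltnS leq_pred.
  apply: eq_big => v.
    rewrite ffunE eqxx; apply/idP/andP => [vm|[h _]].
      split; first by rewrite -val_eqE /= upr.
      apply/eqP/ffunP => i; rewrite !ffunE; case: eqP => // ->.
      by rewrite upr //= inord_val.
    (* Out of range [inord] falls back to [ord0], so [v r = ord_max] would give [up v r = ord0]. *)
    apply: contra h => /eqP ->.
    by rewrite /inord /insubd insubN //= ltnn.
  move=> vm; apply: eq_label_det => k kn; congr lab; apply: eq_point => i.
  rewrite ffunE; case: eqP => [->|_]; last by rewrite addn0.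
  by rewrite upr // addn1.
rewrite [X in _ + X](bigID (fun v : {ffun 'I_n.+1 -> 'I_N.+1} => v r == ord0)) /=.
by rewrite addrCA F2_addrr addr0.
Qed.

Definition extend0 (v : {ffun 'I_n -> 'I_N.+1}) : {ffun 'I_n.+1 -> 'I_N.+1} :=
  [ffun i => if unlift ord_max i is Some j then v j else ord0].

(** The lifted ordering increments the new coordinate last, hence not before vertex [n.+1]. *)
Lemma point_extend0 (s : 'S_n) (v : {ffun 'I_n -> 'I_N.+1}) (k : nat) : (k <= n)%N ->
  vtx (lift_perm ord_max ord_max s) (fun i => extend0 v i) k = vtx s (fun i => v i) k.
Proof.
move=> kn; apply: FunctionalExtensionality.functional_extensionality => r.
rewrite /vtx /point; case: insubP => [i ri ir|]; case: insubP => [j rj jr|] //.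
- rewrite ffunE; have -> : i = lift ord_max j.
    by apply: val_inj; rewrite [RHS]lift_max ir.
  by rewrite liftK lift_perm_lift; congr (_ + nat_of_bool (_ < _))%N; exact: lift_max.
- move=> rn; have -> : i = ord_max.
    apply: val_inj => /=; apply/eqP; rewrite eqn_leq -ltnS ltn_ord /=.
    by rewrite (_ : (i : nat) = r) // leqNgt.
  by rewrite ffunE unlift_none lift_perm_id /= ltnNge kn.
- by rewrite (leq_trans rj) ?leqnSn.
Qed.

(** Each determinant is expanded over the facets of its simplex. Inner facets cancel, first and last
    facets telescope, and what survives is the triangulation of the face where the last coordinate
    is 0. *)
Lemma simplex_sum_face : simplex_sum n.+1 N lab = simplex_sum n N lab.
Proof.
rewrite /simplex_sum.
have expand (s : 'S_n.+1) (v : {ffun 'I_n.+1 -> 'I_N.+1}) :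
    label_det n.+2 (fun k => lab (vtx s (fun i => v i) k)) =
    \sum_(i < n.+2) label_det n.+1 (fun k => lab (vtx s (fun i => v i) (bump i k))).
  apply: label_det_expand => k _; have [|//] := Hp (u := fun i => (v i + (s i < k))%N) _.
  by move=> i; apply: leq_addb; rewrite -ltnS.
under eq_bigr => s _ do under eq_bigr => v _ do rewrite expand.
under eq_bigr => s _ do rewrite exchange_big /=.
rewrite exchange_big big_ord_recl big_ord_recr /=.
rewrite [X in _ + (X + _)]big1 ?add0r => [|i _]; last first.
  by apply: inner_facets_cancel; rewrite /bump /= add1n ltnS /= ltn_ord.
under eq_bigr => s _ do under eq_bigr => v _ do rewrite first_facet.
pose F (s : 'S_n.+1) := \sum_(v : {ffun 'I_n.+1 -> 'I_N.+1}) G s (fun r => v r + (s r == ord_max))%N.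
have -> : \sum_(s : 'S_n.+1) \sum_(v : {ffun 'I_n.+1 -> 'I_N.+1})
    G (s * rot_perm)%g (fun r => v r + ((s * rot_perm)%g r == ord_max))%N = \sum_s F s.
  by rewrite [RHS](reindex_inj (mulIg rot_perm)).
have -> : \sum_(s : 'S_n.+1) \sum_(v : {ffun 'I_n.+1 -> 'I_N.+1})
    label_det n.+1 (fun k => lab (vtx s (fun i => v i) (bump n.+1 k))) =
  \sum_(s : 'S_n.+1) \sum_(v : {ffun 'I_n.+1 -> 'I_N.+1}) G s (fun i => v i).
  apply: eq_bigr => s _; apply: eq_bigr => v _; apply: eq_label_det => k kn.
  by rewrite /bump leqNgt kn.
rewrite -big_split /=.
have tel (s : 'S_n.+1) : F s +
  \sum_(v : {ffun 'I_n.+1 -> 'I_N.+1}) G s (fun i => v i) =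
  \sum_(v : {ffun 'I_n.+1 -> 'I_N.+1} | v ((s^-1)%g ord_max) == ord0) G s (fun i => v i).
  rewrite -telescope ?permKV //; congr (_ + _); apply: eq_bigr => v _.
  apply: eq_label_det => k kn; congr lab; apply: eq_point => i.
  by rewrite -{1}[ord_max](permKV s) (inj_eq perm_inj).
under eq_bigr do rewrite tel.
(* Bottom faces orthogonal to a direction other than the last one vanish by [lower_face]. *)
rewrite (bigID (fun s : 'S_n.+1 => s ord_max == ord_max)) /= [X in _ + X]big1 ?addr0; last first.
  move=> s sm; apply: big1 => v /eqP v0.
  apply: (lower_face (r := (s^-1)%g ord_max)); rewrite ?permKV ?v0 //.
  - by move=> i; rewrite -ltnS.
  - by apply: contra sm => /eqP {1}<-; rewrite permKV.
rewrite (reindex (lift_perm ord_max ord_max)) /=; last first.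
  (* The inverse of [lift_perm ord_max ord_max], made total by fallback values: where [s] fixes
     [ord_max], [unlift] succeeds and [f s] is injective. *)
  pose f (s : 'S_n.+1) : {ffun 'I_n -> 'I_n} :=
    [ffun k => odflt k (unlift ord_max (s (lift ord_max k)))].
  exists (fun s => insubd (1%g : {perm 'I_n}) (f s)) => [s _|s].
    rewrite (_ : f _ = val s) ?valKd //; apply/ffunP => k.
    by rewrite ffunE lift_perm_lift liftK -pvalE.
  rewrite inE => /eqP sm.
  have fK k : lift ord_max (f s k) = s (lift ord_max k).
    rewrite ffunE; case: unliftP => [j -> //|e].
    by have := neq_lift ord_max k; rewrite -(inj_eq (@perm_inj _ s)) sm e eqxx.
  have finj : injectiveb (f s).
    by apply/injectiveP => k k' /(congr1 (lift ord_max)); rewrite !fK => /perm_inj /lift_inj.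
  apply/permP => k.
  case: (unliftP ord_max k) => [k'|] ->; last by rewrite lift_perm_id sm.
  by rewrite lift_perm_lift -fK -pvalE insubdK.
apply: eq_big => [s|s _]; first by rewrite lift_perm_id eqxx.
have -> : ((lift_perm ord_max ord_max s)^-1)%g ord_max = ord_max :> 'I_n.+1.
  by rewrite lift_permV lift_perm_id.
rewrite (reindex extend0) /=.
  apply: eq_big => [v|v _]; first by rewrite ffunE unlift_none eqxx.
  by apply: eq_label_det => k kn; rewrite point_extend0.
exists (fun v : {ffun 'I_n.+1 -> 'I_N.+1} => [ffun j => v (lift ord_max j)]) => v.
  by move=> _; apply/ffunP => i; rewrite !ffunE liftK.
move/eqP => v0; apply/ffunP => i; rewrite !ffunE.
by case: unliftP => [j|] ->; rewrite ?ffunE.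
Qed.

Lemma proper_face : proper n N lab.
Proof.
move=> u uN; pose u' (i : 'I_n.+1) := if unlift ord_max i is Some j then u j else 0%N.
have -> : point u = point u'.
  apply: FunctionalExtensionality.functional_extensionality => r.
  rewrite /point; case: insubP => [i ri ir|rn]; case: insubP => [j rj jr|] //.
  - rewrite /u'; have -> : j = lift ord_max i.
      by apply: val_inj; rewrite [RHS]lift_max ir.
    by rewrite liftK.
  - by rewrite (leq_trans ri) ?leqnSn.
  - rewrite /u'; have -> : j = ord_max.
      apply: val_inj => /=; apply/eqP; rewrite eqn_leq -ltnS ltn_ord /=.
      by rewrite (_ : (j : nat) = r) // leqNgt.
    by rewrite unlift_none.
have [|H1 [H2 H3]] := Hp (u := u').
  by move=> i; rewrite /u'; case: unliftP.
split; first by have := H2 ord_max; rewrite /u' unlift_none; apply.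
split => i ui.
  by have := H2 (lift ord_max i); rewrite /u' liftK lift_max; apply.
by have := H3 (lift ord_max i); rewrite /u' liftK lift_max; apply.
Qed.
End Step.

(** Induction on faces ends in dimension 0, with one simplex, a single vertex labelled 0. *)
Lemma simplex_sum1 n N lab : proper n N lab -> simplex_sum n N lab = 1.
Proof.
elim: n => [|n IH] Hp; last by rewrite simplex_sum_face // IH //; exact: proper_face.
rewrite /simplex_sum.
have H s v : label_det 1 (fun k => lab (vtx s (fun i : 'I_0 => v i) k)) = 1.
  rewrite /label_det det_mx11 mxE.
  have [|+ _] := Hp (fun i : 'I_0 => (v i + (s i < 0))%N) _; first by case.
  by rewrite leqn0 => ->.
under eq_bigr => s _ do under eq_bigr => v _ do rewrite H.
by rewrite !sumr_const card_ffun !card_ord card_Sn.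
Qed.

(** An odd sum has a nonzero term, that is, a simplex on which no label is missing; it lies in the
    unit cell at [v]. *)
Theorem kuhn n N lab : proper n N lab ->
  exists v : nat -> nat, forall i, (i <= n)%N -> exists u : 'I_n -> nat,
    [/\ lab (point u) = i, forall r, (u r <= N.+1)%N & forall r : 'I_n, (v r <= u r <= (v r).+1)%N].
Proof.
move=> Hp.
have [s [v Hsv]] : exists (s : 'S_n) (v : {ffun 'I_n -> 'I_N.+1}),
    label_det n.+1 (fun k => lab (vtx s (fun i => v i) k)) != 0.
  have [/existsP[s /existsP[v h]]|/existsPn H] := boolP [exists s : 'S_n, exists v : {ffun 'I_n -> 'I_N.+1},
    label_det n.+1 (fun k => lab (vtx s (fun i => v i) k)) != 0]; first by exists s, v.
  have := simplex_sum1 Hp; rewrite /simplex_sum big1 // => s _; apply: big1 => v _.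
  by have /existsPn/(_ v)/negPn/eqP := H s.
exists (point (fun i => v i)) => i ni.
have [k kn lk] : exists2 k, (k < n.+1)%N & lab (vtx s (fun i => v i) k) = i.
  have : [exists k : 'I_n.+1, lab (vtx s (fun i => v i) k) == i].
    apply: contraR Hsv => /existsPn H; apply/eqP.
    apply: (@label_det_missing _ _ i) => // k kn e.
    by have := H (Ordinal kn); rewrite /= e eqxx.
  by case/existsP => k /eqP lk; exists k.
exists (fun r => (v r + (s r < k))%N); split => // r.
  by apply: leq_addb; rewrite -ltnS.
by rewrite /point valK leq_addr leq_addb.
Qed.

(** Translation into the standard order on [nat] and plain functions, the form applied to the orbit
    closure. *)
Lemma kuhn_nat (n N : nat) (lab : (nat -> nat) -> nat) :
  (forall x : nat -> nat, (forall r, (r < n)%coq_nat -> (x r <= S N)%coq_nat) ->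
     (forall r, (n <= r)%coq_nat -> x r = 0%N) ->
     (lab x <= n)%coq_nat /\
     (forall r, (r < n)%coq_nat -> x r = 0%N -> (lab x <= r)%coq_nat) /\
     (forall r, (r < n)%coq_nat -> x r = S N -> lab x <> r)) ->
  exists v : nat -> nat, forall i, (i <= n)%coq_nat -> exists x : nat -> nat,
    lab x = i /\ (forall r, (r < n)%coq_nat -> (x r <= S N)%coq_nat) /\
    (forall r, (n <= r)%coq_nat -> x r = 0%N) /\
    (forall r, (r < n)%coq_nat -> (v r <= x r)%coq_nat /\ (x r <= S (v r))%coq_nat).
Proof.
move=> H.
have pt (u : 'I_n -> nat) r (rn : (r < n)%N) : point u r = u (Ordinal rn).
  by rewrite /point insubT.
have pt0 (u : 'I_n -> nat) r : (n <= r)%coq_nat -> point u r = 0%N.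
  by move/leP => rn; rewrite /point insubN // -leqNgt.
have ptN (u : 'I_n -> nat) : (forall i, (u i <= N.+1)%N) ->
    forall r, (r < n)%coq_nat -> (point u r <= S N)%coq_nat.
  by move=> uN r /ltP rn; apply/leP; rewrite (pt _ _ rn).
have [v Hv] : exists v : nat -> nat, forall i, (i <= n)%N -> exists u : 'I_n -> nat,
    [/\ lab (point u) = i, forall r, (u r <= N.+1)%N & forall r : 'I_n, (v r <= u r <= (v r).+1)%N].
  apply: kuhn => u uN; have [H1 [H2 H3]] := H _ (ptN u uN) (pt0 u).
  split; first by apply/leP.
  have pto (i : 'I_n) : point u i = u i by rewrite (pt _ _ (ltn_ord i)); congr u; exact: val_inj.
  by split=> i ui; [apply/leP; apply: H2 | apply: H3]; rewrite ?pto //; apply/ltP.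
exists v => i /leP /Hv[u [lu uN vu]]; exists (point u); split => //; split; first exact: ptN.
split; first exact: pt0.
by move=> r /ltP rn; rewrite (pt _ _ rn); have /andP[/leP ? /leP ?] := vu (Ordinal rn).
Qed.
End Kuhn.

(** * Compact metric spaces and covering dimension *)

Lemma inv_succ_pos i : 0 < / INR (i + 1).
Proof. apply Rinv_0_lt_compat, lt_0_INR; lia. Qed.

Lemma inv_succ_small eps : 0 < eps -> exists i, / INR (i + 1) < eps.
Proof.
  intro He. destruct (archimed_cor1 eps He) as (N & HN & HN0).
  exists N. eapply Rle_lt_trans; [|exact HN].
  apply Rinv_le_contravar; [now apply lt_0_INR|apply le_INR; lia].
Qed.

Section Topology.
Variable X : Type.
Variable d : X -> X -> R.
Hypothesis Hd : is_metric X d.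

(** Small sets replace balls, so cells may be empty and no centres have to be found. *)
Definition totally_bounded : Prop := forall eps, 0 < eps -> exists l : list (X -> Prop),
  (forall x, exists A, In A l /\ A x) /\
  (forall A, In A l -> forall x y, A x -> A y -> d x y <= eps).

(** The explicit rate is the one provided by points chosen in nested sets of diameter at most
    [1/(i+1)]. *)
Definition complete : Prop := forall u : nat -> X,
  (forall i j, (i <= j)%nat -> d (u i) (u j) <= / INR (i + 1)) ->
  exists x, forall eps, 0 < eps -> exists N, forall i, (N <= i)%nat -> d (u i) x < eps.

(** If no finite subfamily covers, there are nested sets of shrinking diameter, none finitely
    covered. They shrink to a point, and a single open set around that point covers one of them. *)
Lemma complete_totally_bounded_compact : complete -> totally_bounded -> compact_space X d.
Proof.
  intros Hc Ht F HF Hcov. apply NNPP; intro Hno.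
  set (bad := fun A : X -> Prop => ~ exists l : list (X -> Prop),
    (forall U, In U l -> F U) /\ forall x, A x -> exists U, In U l /\ U x).
  (* Keeping [bad A] under the existential lets choice produce a function defined on all sets. *)
  assert (step : forall (k : nat) (A : X -> Prop), exists B : X -> Prop, bad A ->
    bad B /\ (forall x, B x -> A x) /\ (forall x y, B x -> B y -> d x y <= / INR (k + 1))).
  { intros k A. destruct (classic (bad A)) as [HA|HA]; [|exists A; tauto].
    destruct (Ht _ (inv_succ_pos k)) as (l & Hl & Hdiam).
    destruct (classic (exists B, In B l /\ bad (fun x => A x /\ B x))) as [(B & HB & HAB)|Hall].
    - exists (fun x => A x /\ B x); intros _; split; [easy|split; [tauto|]].
      intros x y [_ Bx] [_ By]. now apply (Hdiam B).
    - exfalso. apply HA.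
      assert (H : exists l', (forall U, In U l' -> F U) /\
        forall x B, In B l -> A x -> B x -> exists U, In U l' /\ U x).
      { clear Hl Hdiam. induction l as [|B l IH].
        - exists nil; firstorder.
        - destruct IH as (l1 & Hl1 & Hc1).
          { intros (B' & HB' & HAB'). apply Hall. exists B'; simpl; tauto. }
          destruct (classic (exists l2, (forall U, In U l2 -> F U) /\
             forall x, A x /\ B x -> exists U, In U l2 /\ U x)) as [(l2 & Hl2 & Hc2)|H2].
          + exists (l1 ++ l2); split.
            * intros U HU; apply in_app_or in HU; firstorder.
            * intros x B' [<-|HB'] HAx HBx.
              -- destruct (Hc2 x) as (U & HU & Ux); [tauto|]. exists U; split; [apply in_or_app|]; tauto.
              -- destruct (Hc1 x B') as (U & HU & Ux); try tauto. exists U; split; [apply in_or_app|]; tauto.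
          + exfalso; apply Hall; exists B; split; [now left|exact H2]. }
      destruct H as (l' & Hl' & Hc'). exists l'; split; [easy|].
      intros x Ax. destruct (Hl x) as (B & HB & Bx). eauto. }
  set (f := fun k A => proj1_sig (constructive_indefinite_description _ (step k A))).
  set (nest := fix nest (k : nat) : X -> Prop := match k with O => fun _ => True | S k => f k (nest k) end).
  assert (Sbad : forall k, bad (nest k)).
  { induction k as [|k IH].
    - intros (l & Hl & Hx). apply Hno. exists l; split; [easy|]. intro x; now apply Hx.
    - simpl; unfold f; destruct constructive_indefinite_description as [B HB]; simpl. now apply HB. }
  assert (Sstep : forall k, (forall x, nest (k + 1)%nat x -> nest k x) /\
    (forall x y, nest (k + 1)%nat x -> nest (k + 1)%nat y -> d x y <= / INR (k + 1))).
  { intro k. replace (nest (k + 1)%nat) with (nest (S k)) by now rewrite Nat.add_1_r.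
    simpl nest; unfold f.
    destruct constructive_indefinite_description as [B HB]; simpl. exact (proj2 (HB (Sbad k))). }
  assert (Smono : forall i j, (i <= j)%nat -> forall x, nest j x -> nest i x).
  { induction 1 as [|j Hij IH]; [easy|]. intros x Hx. apply IH. apply Sstep.
    now rewrite Nat.add_1_r. }
  assert (Sne : forall k, exists x, nest (k + 1)%nat x).
  { intro k. apply NNPP; intro He. apply (Sbad (k + 1)%nat). exists nil; split; [easy|].
    intros x Hx; exfalso; eauto. }
  set (u := fun k => proj1_sig (constructive_indefinite_description _ (Sne k))).
  assert (Hu : forall k, nest (k + 1)%nat (u k)).
  { intro k; unfold u; destruct constructive_indefinite_description; easy. }
  destruct (Hc u) as (x & Hx).
  { intros i j Hij. apply Sstep; [apply Hu|]. apply Smono with (j + 1)%nat; [lia|apply Hu]. }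
  destruct (Hcov x) as (U & FU & Ux).
  destruct (HF U FU x Ux) as (eps & He & HU).
  destruct (inv_succ_small (eps / 2)) as (i & Hi); [lra|].
  destruct (Hx (eps / 2)) as (N & HN); [lra|].
  apply (Sbad (i + 1)%nat). exists (U :: nil); split; [intros V [<-|[]]; easy|].
  intros z Hz. exists U; split; [now left|]. apply HU.
  (* This index serves both estimates: [u j] is close to the limit [x] and lies in the small bad set
     [nest (i + 1)]. *)
  set (j := Nat.max i N).
  assert (Hj1 : d (u j) x < eps / 2) by (apply HN; lia).
  assert (Hj2 : d (u j) z <= / INR (i + 1)).
  { apply Sstep; [|easy]. apply Smono with (j + 1)%nat; [lia|apply Hu]. }
  destruct Hd as (_ & _ & Hsym & Htri).
  pose proof (Htri x (u j) z). rewrite (Hsym x (u j)) in H. lra.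
Qed.

(** Finitely many balls cover whose doubles lie in members of [U]; the least of their radii
    works. *)
Lemma lebesgue_number m U : compact_space X d -> finite_open_cover X d m U ->
  exists delta, 0 < delta /\
    forall x, exists i, (i < m)%nat /\ forall y, d x y < delta -> U i y.
Proof.
  intros Hc [HU Hcov]. destruct Hd as (_ & Hd0 & Hsym & Htri).
  set (F := fun W : X -> Prop => exists x e i, 0 < e /\ (i < m)%nat /\
    (W = fun y => d x y < e) /\ forall y, d x y < 2 * e -> U i y).
  destruct (Hc F) as (l & HlF & Hl).
  - intros W (x & e & i & He & _ & -> & _) y Hy. exists (e - d x y); split; [lra|].
    intros z Hz. pose proof (Htri x y z). lra.
  - intro x. destruct (Hcov x) as (i & Hi & Ux). destruct (HU i Hi x Ux) as (e & He & Hball).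
    exists (fun y => d x y < e / 2). split.
    + exists x, (e / 2), i. repeat split; try easy; [lra|]. intros y Hy; apply Hball; lra.
    + rewrite (proj2 (Hd0 x x) eq_refl); lra.
  - assert (H : exists delta, 0 < delta /\ forall W, In W l -> forall x, W x ->
      exists i, (i < m)%nat /\ forall y, d x y < delta -> U i y).
    { clear Hl. induction l as [|W l IH].
      - exists 1; split; [lra|]. intros W [].
      - destruct IH as (d1 & Hd1 & H1); [intros V HV; apply HlF; now right|].
        destruct (HlF W (or_introl eq_refl)) as (x & e & i & He & Hi & -> & Hball).
        exists (Rmin d1 e); split; [now apply Rmin_pos|].
        intros V [<-|HV] y Hy.
        + exists i; split; [easy|]. intros z Hz. apply Hball.
          pose proof (Htri x y z). pose proof (Rmin_r d1 e). lra.
        + destruct (H1 V HV y Hy) as (i' & Hi' & Hb). exists i'; split; [easy|].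
          intros z Hz; apply Hb. pose proof (Rmin_l d1 e). lra. }
    destruct H as (delta & Hdelta & H). exists delta; split; [easy|].
    intro x. destruct (Hl x) as (W & HW & Wx). eauto.
Qed.

(** The easy half of Ostrand's criterion: sets of one colour are disjoint, so a point lies in at
    most one set for each of the [n + 1] colours. A Lebesgue number turns small diameter into
    refinement. *)
Lemma coloured_dim_le n : inhabited X -> compact_space X d ->
  (forall eps, 0 < eps -> exists fam : nat -> list (X -> Prop),
     (forall j A, (j <= n)%nat -> In A (fam j) -> Defs.open_set X d A /\ forall x y, A x -> A y -> d x y < eps) /\
     (forall j A B x, (j <= n)%nat -> In A (fam j) -> In B (fam j) -> A x -> B x -> A = B) /\
     (forall x, exists j A, (j <= n)%nat /\ In A (fam j) /\ A x)) ->
  covering_dim_le X d n.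
Proof.
  intros [x0] Hc Hfam m U HU.
  destruct (lebesgue_number m U Hc HU) as (delta & Hdelta & HLeb).
  destruct (Hfam delta Hdelta) as (fam & Hopen & Hdisj & Hcov).
  set (dec := fun a b : nat * (X -> Prop) => excluded_middle_informative (a = b)).
  (* The tag lets the colour be read off an index; without duplicates, indices with equal colour and
     equal set coincide. *)
  set (all := nodup dec (flat_map (fun j => map (pair j) (fam j)) (seq 0 (n + 1)))).
  assert (Hall : forall j A, In (j, A) all <-> (j <= n)%nat /\ In A (fam j)).
  { intros j A. unfold all. rewrite nodup_In, in_flat_map. split.
    - intros (j' & Hj' & HA). apply in_seq in Hj'. apply in_map_iff in HA.
      destruct HA as (A' & E & HA'). injection E as -> ->. split; [lia|easy].
    - intros [Hj HA]. exists j; split; [apply in_seq; lia|now apply in_map]. }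
  set (dflt := (0%nat, fun _ : X => False)).
  assert (Hnth : forall i, (i < length all)%nat -> (fst (nth i all dflt) <= n)%nat /\
      In (snd (nth i all dflt)) (fam (fst (nth i all dflt)))).
  { intros i Hi. apply Hall. rewrite <- surjective_pairing. now apply nth_In. }
  exists (length all), (fun i => snd (nth i all dflt)). split; [split|split].
  - intros i Hi. now apply (Hopen (fst (nth i all dflt))); apply Hnth.
  - intro x. destruct (Hcov x) as (j & A & Hj & HA & Ax).
    destruct (In_nth all (j, A) dflt) as (i & Hi & E); [now apply Hall|].
    exists i; split; [easy|]. now rewrite E.
  - intros i Hi. destruct (Hnth i Hi) as [_ HA].
    destruct (classic (exists x, snd (nth i all dflt) x)) as [(x & Ax)|He].
    + destruct (HLeb x) as (i' & Hi' & Hball). exists i'; split; [easy|].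
      intros y Ay. apply Hball. now apply (Hopen _ _ (proj1 (Hnth i Hi)) HA).
    + destruct (HLeb x0) as (i' & Hi' & _). exists i'; split; [easy|]. intros y Ay. exfalso; eauto.
  - intros x l Hl HV.
    rewrite <- (length_map (fun i => fst (nth i all dflt)) l), <- (length_seq (n + 1) 0).
    apply NoDup_incl_length.
    + apply NoDup_map_NoDup_ForallPairs; [|easy].
      intros i i' Hi Hi' E. destruct (HV i Hi) as [Hil Hix]. destruct (HV i' Hi') as [Hil' Hix'].
      apply (NoDup_nth all dflt); try easy; [apply NoDup_nodup|].
      rewrite (surjective_pairing (nth i all dflt)), (surjective_pairing (nth i' all dflt)).
      f_equal; [easy|]. apply (Hdisj (fst (nth i all dflt))) with x; try easy.
      * now apply Hnth.
      * now apply Hnth.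
      * rewrite E; now apply Hnth.
    + intros j Hj. apply in_map_iff in Hj. destruct Hj as (i & <- & Hi).
      apply in_seq. destruct (Hnth i) as [H _]; [now apply HV|]. lia.
Qed.
End Topology.

(** * The generating sequence *)

Definition clamp (s : R) : R := Rmax 0 (Rmin 1 s).

Lemma clamp_bounds s : 0 <= clamp s <= 1.
Proof. unfold clamp, Rmax, Rmin. repeat destruct Rle_dec; lra. Qed.

Lemma clamp_id s : 0 <= s <= 1 -> clamp s = s.
Proof. unfold clamp, Rmax, Rmin. repeat destruct Rle_dec; lra. Qed.

Lemma clamp_dist a b : Rabs (clamp a - clamp b) <= Rabs (a - b).
Proof.
  unfold clamp, Rmax, Rmin.
  repeat destruct Rle_dec; apply Rabs_le; split;
    pose proof (Rle_abs (a - b)); pose proof (Rle_abs (- (a - b))); rewrite Rabs_Ropp in *; lra.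
Qed.

Section Generator.
Variable n : nat.

(** For [r = k mod n] this is [1 - |j|/(k+1)] cut off at 0. For the other [r] it remains 1 up to
    [|j| = k+1] and reaches 0 at [2(k+1)], half the extreme digit. *)
Definition digit_amp (k r : nat) (j : Z) : R :=
  clamp ((if Nat.eqb r (k mod n) then 1 else 2) - IZR (Z.abs j) / IZR (Z.of_nat k + 1)).

Definition base (k : nat) : Z := (8 * (Z.of_nat k + 1))%Z.
(** Division by [base k] rounded to a nearest integer: digits run from [-4(k+1)] to [4(k+1) - 1],
    and integers of both signs have finite expansions. *)
Definition next (k : nat) (u : Z) : Z := ((u + 4 * (Z.of_nat k + 1)) / base k)%Z.
Definition digit (k : nat) (u : Z) : Z := (u - base k * next k u)%Z.

(** As [next] strictly decreases nonzero absolute values and all factors at 0 are 1, fuel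
    [Z.abs_nat u] yields the whole infinite product. *)
Fixpoint amp_fuel (m k r : nat) (u : Z) : R :=
  match m with
  | O => 1
  | S m => digit_amp k r (digit k u) * amp_fuel m (S k) r (next k u)
  end.

Definition amp (k r : nat) (u : Z) : R := amp_fuel (Z.abs_nat u) k r u.

Fixpoint period (k : nat) : Z :=
  match k with O => 1%Z | S k => (base k * period k)%Z end.

Definition gen (t : Z) (r : nat) : R := if Nat.ltb r n then amp 0 r t else 0.

Lemma digit_amp_bounds k r j : 0 <= digit_amp k r j <= 1.
Proof.
  apply clamp_bounds.
Qed.

Lemma level_pos k : 0 < IZR (Z.of_nat k + 1).
Proof. apply IZR_lt; lia. Qed.

Lemma digit_amp_0 k r : digit_amp k r 0 = 1.
Proof.
  unfold digit_amp, clamp; simpl Z.abs.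
  replace (0 / IZR (Z.of_nat k + 1)) with 0 by (field; pose proof (level_pos k); lra).
  destruct Nat.eqb; rewrite Rmin_left by lra; apply Rmax_right; lra.
Qed.

Lemma digit_amp_far k r j : (2 * (Z.of_nat k + 1) <= Z.abs j)%Z -> digit_amp k r j = 0.
Proof.
  intro H; unfold digit_amp, clamp.
  assert (2 <= IZR (Z.abs j) / IZR (Z.of_nat k + 1)).
  { pose proof (level_pos k).
    apply Rmult_le_reg_r with (IZR (Z.of_nat k + 1)); [easy|].
    unfold Rdiv; rewrite Rmult_assoc, Rinv_l, Rmult_1_r by lra.
    rewrite <- mult_IZR; apply IZR_le; lia. }
  apply Rmax_left.
  eapply Rle_trans; [apply Rmin_r|]; destruct Nat.eqb; lra.
Qed.

Lemma digit_amp_lipschitz k r j : Rabs (digit_amp k r (j + 1) - digit_amp k r j) <= / IZR (Z.of_nat k + 1).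
Proof.
  unfold digit_amp; eapply Rle_trans; [apply clamp_dist|].
  pose proof (level_pos k).
  match goal with |- Rabs (?c - ?x / ?m - (?c - ?y / ?m)) <= _ =>
    replace (c - x / m - (c - y / m)) with ((y - x) * / m) by (field; lra) end.
  rewrite Rabs_mult, (Rabs_right (/ _)) by (apply Rle_ge, Rlt_le, Rinv_0_lt_compat; lra).
  rewrite <- (Rmult_1_l (/ IZR (Z.of_nat k + 1))) at 2.
  apply Rmult_le_compat_r; [apply Rlt_le, Rinv_0_lt_compat; lra|].
  rewrite <- minus_IZR, <- abs_IZR; apply IZR_le; lia.
Qed.

Lemma base_pos k : (0 < base k)%Z.
Proof. unfold base; lia. Qed.

Lemma next_eq k u J j : (u = J * base k + j)%Z ->
  (- (4 * (Z.of_nat k + 1)) <= j < 4 * (Z.of_nat k + 1))%Z ->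
  next k u = J /\ digit k u = j.
Proof.
  intros -> Hj.
  assert (next k (J * base k + j) = J).
  { unfold next; symmetry; apply Z.div_unique with (j + 4 * (Z.of_nat k + 1))%Z;
    unfold base; [left|]; lia. }
  split; [easy|]. unfold digit; rewrite H; lia.
Qed.

Lemma next_small k u : u <> 0%Z -> (Z.abs_nat (next k u) < Z.abs_nat u)%nat.
Proof.
  intro Hu. set (M := (Z.of_nat k + 1)%Z). assert (1 <= M)%Z by lia.
  assert (Hq : base k = (8 * M)%Z) by reflexivity.
  assert (Hn : next k u = ((u + 4 * M) / (8 * M))%Z) by reflexivity.
  pose proof (Z.div_mod (u + 4 * M) (8 * M) ltac:(lia)) as E.
  pose proof (Z.mod_pos_bound (u + 4 * M) (8 * M) ltac:(lia)) as B.
  rewrite <- Hn in E. revert E B. generalize (next k u) ((u + 4 * M) mod (8 * M))%Z.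
  intros v m E B. clear Hn Hq. clearbody M.
  assert (Z.abs v < Z.abs u)%Z; [|lia].
  destruct (Z_le_gt_dec u 0).
  - assert (v <= 0)%Z by nia. assert (u < v)%Z by nia. lia.
  - assert (0 <= v)%Z by nia. assert (v < u)%Z by nia. lia.
Qed.

Lemma next_0 k : next k 0 = 0%Z.
Proof. apply (next_eq k 0 0 0); lia. Qed.

Lemma amp_fuel_0 m k r : amp_fuel m k r 0 = 1.
Proof.
  revert k; induction m as [|m IH]; intro k; [easy|].
  simpl; unfold digit; rewrite next_0, Z.mul_0_r, digit_amp_0, IH; lra.
Qed.

Lemma amp_fuel_stable m k r u : (Z.abs_nat u <= m)%nat -> amp_fuel m k r u = amp k r u.
Proof.
  revert m k u.
  assert (H : forall b m m' k u, (Z.abs_nat u <= b)%nat -> (b <= m)%nat -> (b <= m')%nat ->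
     amp_fuel m k r u = amp_fuel m' k r u).
  { induction b as [|b IH]; intros m m' k u Hu Hm Hm'.
    - assert (u = 0)%Z as -> by lia. now rewrite !amp_fuel_0.
    - destruct (Z.eq_dec u 0) as [->|nu]; [now rewrite !amp_fuel_0|].
      destruct m as [|m]; [lia|]; destruct m' as [|m']; [lia|]; simpl.
      f_equal; apply IH; try lia. pose proof (next_small k u nu); lia. }
  intros m k u Hu; unfold amp; apply (H (Z.abs_nat u)); lia.
Qed.

Lemma amp_0 k r : amp k r 0 = 1.
Proof. reflexivity. Qed.

Lemma amp_eq k r u : amp k r u = digit_amp k r (digit k u) * amp (S k) r (next k u).
Proof.
  destruct (Z.eq_dec u 0) as [->|nu].
  - unfold digit; rewrite next_0, Z.mul_0_r, digit_amp_0, !amp_0; lra.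
  - rewrite <- (amp_fuel_stable (S (Z.abs_nat u)) k) by lia; simpl.
    f_equal; apply amp_fuel_stable. pose proof (next_small k u nu); lia.
Qed.

Lemma amp_bounds k r u : 0 <= amp k r u <= 1.
Proof.
  unfold amp; generalize (Z.abs_nat u); intro m; revert k u.
  induction m as [|m IH]; intros k u; simpl; [lra|].
  pose proof (digit_amp_bounds k r (digit k u)); pose proof (IH (S k) (next k u)); nra.
Qed.

(** The range of [j] is closed although that of digits is half-open: [j = 4(k+1)] is really the
    digit [-4(k+1)] after a carry, and both sides vanish there. *)
Lemma amp_digit k r J j : (Z.abs j <= 4 * (Z.of_nat k + 1))%Z ->
  amp k r (J * base k + j) = digit_amp k r j * amp (S k) r J.
Proof.
  intro Hj.
  destruct (Z.eq_dec j (4 * (Z.of_nat k + 1))) as [->|nj].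
  - destruct (next_eq k (J * base k + 4 * (Z.of_nat k + 1)) (J + 1) (- (4 * (Z.of_nat k + 1)))%Z)
      as [_ E2]; [unfold base; lia|lia|].
    rewrite amp_eq, E2, !digit_amp_far by lia; lra.
  - destruct (next_eq k (J * base k + j) J j) as [E1 E2]; [lia|lia|].
    now rewrite amp_eq, E1, E2.
Qed.

Lemma amp_small k r j : (Z.abs j <= 4 * (Z.of_nat k + 1))%Z -> amp k r j = digit_amp k r j.
Proof. intro Hj. rewrite <- (Z.add_0_l j) at 1. rewrite <- (Z.mul_0_l (base k)), amp_digit, amp_0 by easy. lra. Qed.

(** By the closed range in [amp_digit], a unit step changes only the factor of the lowest digit,
    even across a carry. *)
Lemma amp_lipschitz k r u : Rabs (amp k r (u + 1) - amp k r u) <= / IZR (Z.of_nat k + 1).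
Proof.
  pose proof (base_pos k).
  pose proof (Z.div_mod (u + 4 * (Z.of_nat k + 1)) (base k) ltac:(lia)) as E.
  pose proof (Z.mod_pos_bound (u + 4 * (Z.of_nat k + 1)) (base k) ltac:(lia)) as B.
  fold (next k u) in E. set (J := next k u) in *.
  set (j := ((u + 4 * (Z.of_nat k + 1)) mod base k - 4 * (Z.of_nat k + 1))%Z).
  assert (Hb : base k = (8 * (Z.of_nat k + 1))%Z) by reflexivity.
  assert (Eu : (u = J * base k + j)%Z) by lia. clearbody J. rewrite Eu.
  assert (- (4 * (Z.of_nat k + 1)) <= j < 4 * (Z.of_nat k + 1))%Z by lia. clearbody j.
  rewrite <- Z.add_assoc, !amp_digit by lia.
  rewrite <- Rmult_minus_distr_r, Rabs_mult.
  pose proof (amp_bounds (S k) r J). rewrite (Rabs_right (amp _ _ _)) by lra.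
  pose proof (digit_amp_lipschitz k r j). pose proof (Rabs_pos (digit_amp k r (j + 1) - digit_amp k r j)). nra.
Qed.

Lemma period_pos k : (Z.of_nat k + 1 <= period k)%Z.
Proof.
  induction k as [|k IH]; [simpl; lia|].
  change (period (S k)) with (base k * period k)%Z. unfold base; nia.
Qed.

Lemma nearest_multiple (p t : Z) : (0 < p)%Z -> exists J s, (t = J * p + s /\ 2 * Z.abs s <= p)%Z.
Proof.
  intro Hp.
  pose proof (Z.div_mod t p ltac:(lia)). pose proof (Z.mod_pos_bound t p Hp).
  destruct (Z_le_gt_dec (2 * (t mod p)) p).
  - exists (t / p)%Z, (t mod p)%Z; lia.
  - exists (t / p + 1)%Z, (t mod p - p)%Z; lia.
Qed.

(* At scale [period k] the generator is a string of copies of its central block, each multiplied by a slowly varying amplitude. *)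
Lemma amp_block k r : forall J s, (2 * Z.abs s <= period k)%Z ->
  amp 0 r (J * period k + s) = amp k r J * amp 0 r s /\
  ((period k <= 3 * Z.abs s)%Z -> amp 0 r (J * period k + s) = 0).
Proof.
  induction k as [|k IH]; intros J s Hs.
  - change (period 0) with 1%Z in *. assert (s = 0)%Z as -> by lia. rewrite amp_0. split; [|lia].
    replace (J * 1 + 0)%Z with J by lia. lra.
  - pose proof (period_pos k).
    change (period (S k)) with (base k * period k)%Z in *.
    destruct (nearest_multiple (period k) s ltac:(lia)) as (j & s' & Es & Hs').
    set (M := (Z.of_nat k + 1)%Z). assert (1 <= M)%Z by lia.
    assert (Hb : base k = (8 * M)%Z) by reflexivity.
    assert (Ha : (Z.abs (j * period k) = Z.abs j * period k)%Z)
      by (rewrite Z.abs_mul, (Z.abs_eq (period k)); lia).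
    assert (Hj : (Z.abs j <= 4 * M)%Z).
    { clearbody M. rewrite Hb in *. subst s.
      assert (2 * (Z.abs j * period k) <= 8 * (M * period k) + period k)%Z by lia.
      assert (2 * Z.abs j <= 8 * M + 1)%Z by nia. lia. }
    destruct (IH (J * base k + j)%Z s' Hs') as [E1 Z1].
    destruct (IH j s' Hs') as [E2 Z2].
    replace (J * (base k * period k) + s)%Z with ((J * base k + j) * period k + s')%Z by (subst s; ring).
    rewrite amp_digit in E1 by exact Hj. rewrite (amp_small k r j) in E2 by exact Hj.
    rewrite Es, E2, E1. split; [ring|].
    (* From a third of the next period on, the digit [j] has absolute value at least [2(k+1)], where
       its tent function is 0. *)
    intro Hfar. rewrite digit_amp_far; [ring|]. rewrite <- Es in Hfar.
    fold M. clearbody M. rewrite Hb in Hfar. subst s.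
    assert (16 * (M * period k) <= 6 * (Z.abs j * period k) + 3 * period k)%Z by lia.
    assert (16 * M <= 6 * Z.abs j + 3)%Z by nia. lia.
Qed.

(** * Rigidity, gaps, windows and scaling of the generator *)

Lemma gen_bounds t r : 0 <= gen t r <= 1.
Proof. unfold gen; destruct Nat.ltb; [apply amp_bounds|lra]. Qed.

Lemma gen_out t r : (n <= r)%nat -> gen t r = 0.
Proof. intro H; unfold gen. destruct (Nat.ltb_spec r n); [lia|easy]. Qed.

Lemma gen_0 r : (r < n)%nat -> gen 0 r = 1.
Proof. intro H; unfold gen. destruct (Nat.ltb_spec r n); [apply amp_0|lia]. Qed.

Lemma gen_block k r J s : (2 * Z.abs s <= period k)%Z ->
  gen (J * period k + s) r = amp k r J * gen s r.
Proof.
  intro H; unfold gen; destruct Nat.ltb; [apply amp_block; easy|lra].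
Qed.

(** Past the midpoint between two copies, [s] is measured from the centre of the neighbouring
    one. *)
Lemma gen_gap k r J s : (period k <= 3 * Z.abs s)%Z -> (3 * Z.abs s <= 2 * period k)%Z ->
  gen (J * period k + s) r = 0.
Proof.
  intros H1 H2; unfold gen; destruct Nat.ltb; [|easy].
  destruct (Z_le_gt_dec (2 * Z.abs s) (period k)); [now apply amp_block|].
  destruct (Z_le_gt_dec 0 s).
  - replace (J * period k + s)%Z with ((J + 1) * period k + (s - period k))%Z by ring.
    apply amp_block; lia.
  - replace (J * period k + s)%Z with ((J - 1) * period k + (s + period k))%Z by ring.
    apply amp_block; lia.
Qed.

Lemma period_large (m : Z) : exists k, (m <= Z.of_nat k /\ m <= period k)%Z.
Proof. exists (Z.to_nat m). pose proof (period_pos (Z.to_nat m)). lia. Qed.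

Lemma level_small eps : 0 < eps -> exists m : Z, forall k, (m <= Z.of_nat k)%Z ->
  / IZR (Z.of_nat k + 1) < eps.
Proof.
  intro He. exists (up (/ eps)). intros k Hk.
  destruct (archimed (/ eps)) as [Ha _].
  rewrite <- (Rinv_inv eps). apply Rinv_lt_contravar.
  - apply Rmult_lt_0_compat; [now apply Rinv_0_lt_compat|apply level_pos].
  - apply IZR_le in Hk. rewrite plus_IZR. lra.
Qed.

(** Translation by [period k] carries each copy of the block to the next one, and their amplitudes
    differ by at most [1/(k+1)]. *)
Lemma gen_rigid eps (m : Z) : 0 < eps -> exists p, (m <= p)%Z /\
  forall t r, Rabs (gen (t + p) r - gen t r) <= eps.
Proof.
  intro He. destruct (level_small eps He) as [m' Hm'].
  destruct (period_large (Z.max m m')) as (k & Hk1 & Hk2).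
  exists (period k); split; [lia|]. intros t r.
  pose proof (period_pos k).
  destruct (nearest_multiple (period k) t ltac:(lia)) as (J & s & -> & Hs).
  replace (J * period k + s + period k)%Z with ((J + 1) * period k + s)%Z by ring.
  rewrite !gen_block, <- Rmult_minus_distr_r, Rabs_mult by easy.
  pose proof (gen_bounds s r). rewrite (Rabs_right (gen s r)) by lra.
  pose proof (amp_lipschitz k r J). pose proof (Rabs_pos (amp k r (J + 1) - amp k r J)).
  specialize (Hm' k ltac:(lia)). nra.
Qed.

Lemma gen_gaps (L : Z) : exists M : Z, (0 <= M)%Z /\ forall m, exists j, (0 <= j <= M)%Z /\
  forall t r, (Z.abs t <= L)%Z -> gen (m + j + t) r = 0.
Proof.
  (* A gap is the middle third between two centres, so it extends a sixth of the period to each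
     side; the extra 6 absorbs rounding of the midpoint. *)
  destruct (period_large (6 * Z.abs L + 6)) as (k & _ & Hk).
  exists (period k); split; [lia|]. intro m.
  pose proof (Z.div_mod m (period k) ltac:(lia)). pose proof (Z.mod_pos_bound m (period k) ltac:(lia)).
  pose proof (Z.div_mod (period k) 2 ltac:(lia)). pose proof (Z.mod_pos_bound (period k) 2 ltac:(lia)).
  (* Chosen so that [J * period k + period k / 2] is the first midpoint not before [m]. *)
  set (J := (if Z_le_gt_dec (m mod period k) (period k / 2) then m / period k else m / period k + 1)%Z).
  exists (J * period k + period k / 2 - m)%Z. split.
  - unfold J; destruct Z_le_gt_dec; lia.
  - intros t r Ht.
    replace (m + (J * period k + period k / 2 - m) + t)%Z with (J * period k + (period k / 2 + t))%Z by ring.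
    apply gen_gap; lia.
Qed.

(** A window short against the period lies either within one copy of the block or within a gap. The
    position [s] is common to all coordinates, while the factor depends on [r]. *)
Lemma gen_windows (L : Z) : exists K : Z, forall m, exists s, (Z.abs s <= K)%Z /\
  forall r, exists c, 0 <= c /\ forall t, (Z.abs t <= L)%Z -> gen (m + t) r = c * gen (s + t) r.
Proof.
  (* A window that may cross the border of a copy stays within [2L] of a half period; it lies in the
     gap if [2L] is at most a sixth of the period. *)
  destruct (period_large (12 * Z.abs L + 6)) as (k & _ & Hk).
  exists (period k). intro m.
  destruct (nearest_multiple (period k) m ltac:(lia)) as (J & s & -> & Hs).
  exists s; split; [lia|]. intro r.
  destruct (Z_le_gt_dec (2 * (Z.abs s + Z.abs L)) (period k)).
  - exists (amp k r J). split; [apply amp_bounds|]. intros t Ht.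
    rewrite <- Z.add_assoc; apply gen_block; lia.
  - exists 0; split; [lra|]. intros t Ht.
    rewrite <- Z.add_assoc, gen_gap by lia; lra.
Qed.

Lemma gen_scaling (r0 : nat) (c eps : R) (L : Z) : (r0 < n)%nat -> 0 <= c <= 1 -> 0 < eps ->
  exists m, forall t r, (Z.abs t <= L)%Z ->
    Rabs (gen (m + t) r - (if Nat.eqb r r0 then c else 1) * gen t r) < eps.
Proof.
  intros Hr0 Hc He. destruct (level_small eps He) as [m' Hm'].
  (* At this level [r0] is the coordinate that decreases first, the amplitude steps are below [eps],
     and the window fits in the central block. *)
  pose (k := (r0 + n * Z.to_nat (Z.max m' (2 * L)))%nat).
  assert (Hk : (Z.max m' (2 * L) <= Z.of_nat k)%Z) by nia.
  assert (Hkr : (k mod n = r0)%nat).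
  { unfold k. rewrite Nat.mul_comm, Nat.Div0.mod_add. now apply Nat.mod_small. }
  pose proof (period_pos k) as Hp. pose proof (level_pos k) as HM.
  set (M := IZR (Z.of_nat k + 1)) in *.
  (* For [0 <= j <= k+1] the amplitude of coordinate [r0] is [1 - j/(k+1)], here within [1/(k+1)] of
     [c]; the other amplitudes are still 1. *)
  pose (j := Int_part ((1 - c) * M)).
  destruct (base_Int_part ((1 - c) * M)) as [Hj1 Hj2]. fold j in Hj1, Hj2.
  assert (0 <= (1 - c) * M <= M) by nra.
  assert (Hj0 : (0 <= j)%Z). { assert (-1 < j)%Z; [|lia]. apply lt_IZR. lra. }
  assert (HjM : (j <= Z.of_nat k + 1)%Z). { apply le_IZR. fold M. lra. }
  exists (j * period k)%Z. intros t r Ht.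
  rewrite gen_block by lia. rewrite <- Rmult_minus_distr_r, Rabs_mult.
  pose proof (gen_bounds t r). rewrite (Rabs_right (gen t r)) by lra.
  assert (Hlt : Rabs (amp k r j - (if Nat.eqb r r0 then c else 1)) < eps).
  { rewrite amp_small by lia. unfold digit_amp, clamp. rewrite Hkr, (Z.abs_eq j) by easy. fold M.
    assert (0 <= IZR j / M <= 1).
    { apply IZR_le in Hj0; apply IZR_le in HjM; fold M in HjM.
      split; [apply Rmult_le_reg_r with M|apply Rmult_le_reg_r with M]; try lra;
      unfold Rdiv; rewrite Rmult_assoc, Rinv_l by lra; lra. }
    destruct Nat.eqb.
    - rewrite Rmin_right, Rmax_right by lra.
      specialize (Hm' k ltac:(lia)). fold M in Hm'.
      replace (1 - IZR j / M - c) with (((1 - c) * M - IZR j) * / M) by (field; lra).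
      pose proof (Rinv_0_lt_compat _ HM).
      rewrite Rabs_mult, !Rabs_right by lra. nra.
    - rewrite Rmin_left, Rmax_right by lra. rewrite Rminus_diag, Rabs_R0; easy. }
  pose proof (Rabs_pos (amp k r j - (if Nat.eqb r r0 then c else 1))). nra.
Qed.
End Generator.

(** * The orbit closure and its dynamics *)

Definition window (L : Z) : list Z := map (fun i => (Z.of_nat i - Z.abs L)%Z) (seq 0 (Z.to_nat (2 * Z.abs L + 1))).

Lemma in_window L t : In t (window L) <-> (Z.abs t <= Z.abs L)%Z.
Proof.
  unfold window. rewrite in_map_iff. split.
  - intros (i & <- & Hi). apply in_seq in Hi. lia.
  - intro Ht. exists (Z.to_nat (t + Z.abs L)). split; [lia|]. apply in_seq. lia.
Qed.

Definition weight (t : Z) : R := IZR (1 + Z.abs t).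

Lemma weight_ge1 t : 1 <= weight t.
Proof. unfold weight. apply (IZR_le 1). lia. Qed.

Section Hull.
Variable n : nat.

(** Membership in the closure of the orbit for the product topology: approximation by translates of
    the generator on each finite window. *)
Definition in_hull (y : Z -> nat -> R) : Prop := forall L eps, 0 < eps ->
  exists m, forall t r, (Z.abs t <= L)%Z -> Rabs (y t r - gen n (m + t) r) < eps.

Definition hull : Type := {y : Z -> nat -> R | in_hull y}.

Definition val (y : hull) : Z -> nat -> R := proj1_sig y.

Lemma hull_near (y : hull) L eps : 0 < eps ->
  exists m, forall t r, (Z.abs t <= L)%Z -> Rabs (val y t r - gen n (m + t) r) < eps.
Proof. apply (proj2_sig y). Qed.

Lemma hull_ext (y z : hull) : (forall t r, val y t r = val z t r) -> y = z.
Proof.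
  intro H. destruct y as [y Hy], z as [z Hz]; unfold val in H; simpl in H.
  apply subset_eq_compat. extensionality t; extensionality r; apply H.
Qed.

Lemma hull_bounds (y : hull) t r : 0 <= val y t r <= 1.
Proof.
  assert (H : forall eps, 0 < eps -> - eps <= val y t r <= 1 + eps).
  { intros eps He. destruct (hull_near y (Z.abs t) eps He) as (m & Hm).
    specialize (Hm t r (Z.le_refl _)). apply Rabs_def2 in Hm.
    pose proof (gen_bounds n (m + t) r). lra. }
  split; apply Rle_plus_epsilon; intros eps He; specialize (H eps He); lra.
Qed.

Lemma hull_out (y : hull) t r : (n <= r)%nat -> val y t r = 0.
Proof.
  intro Hr. apply Rle_antisym; [|apply hull_bounds].
  apply Rle_plus_epsilon; intros eps He. destruct (hull_near y (Z.abs t) eps He) as (m & Hm).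
  specialize (Hm t r (Z.le_refl _)). rewrite gen_out in Hm by easy. apply Rabs_def2 in Hm. lra.
Qed.

(** * The weighted supremum metric *)

Definition dist_set (y z : hull) (v : R) : Prop :=
  exists t r, v = Rabs (val y t r - val z t r) / weight t.

Lemma dist_set_bound y z : bound (dist_set y z).
Proof.
  exists 1. intros v (t & r & ->).
  pose proof (weight_ge1 t). pose proof (hull_bounds y t r). pose proof (hull_bounds z t r).
  assert (Rabs (val y t r - val z t r) <= 1) by (apply Rabs_le; lra).
  apply Rmult_le_reg_r with (weight t); [lra|].
  unfold Rdiv; rewrite Rmult_assoc, Rinv_l by lra. lra.
Qed.

Lemma dist_set_inhabited y z : exists v, dist_set y z v.
Proof. exists (Rabs (val y 0%Z 0%nat - val z 0%Z 0%nat) / weight 0), 0%Z, 0%nat; easy. Qed.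

Definition hdist (y z : hull) : R :=
  proj1_sig (completeness _ (dist_set_bound y z) (dist_set_inhabited y z)).

Lemma hdist_le y z e :
  hdist y z <= e <-> forall t r, Rabs (val y t r - val z t r) <= e * weight t.
Proof.
  unfold hdist; destruct completeness as [s [Hub Hlub]]; simpl. split.
  - intros Hs t r. pose proof (weight_ge1 t).
    assert (Rabs (val y t r - val z t r) / weight t <= e).
    { apply Rle_trans with s; [|easy]. apply Hub. now exists t, r. }
    apply Rmult_le_reg_r with (/ weight t); [apply Rinv_0_lt_compat; lra|].
    rewrite Rmult_assoc, Rinv_r by lra. unfold Rdiv in *; lra.
  - intro H. apply Hlub. intros v (t & r & ->). pose proof (weight_ge1 t).
    apply Rmult_le_reg_r with (weight t); [lra|].
    unfold Rdiv; rewrite Rmult_assoc, Rinv_l by lra. specialize (H t r). lra.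
Qed.

Lemma hdist_coord y z t r : Rabs (val y t r - val z t r) <= hdist y z * weight t.
Proof. apply hdist_le, Rle_refl. Qed.

Lemma hdist_uniform y z e : 0 <= e -> (forall t r, Rabs (val y t r - val z t r) <= e) -> hdist y z <= e.
Proof.
  intros He H. apply hdist_le. intros t r. specialize (H t r). pose proof (weight_ge1 t). nra.
Qed.

Lemma hdist_metric : is_metric hull hdist.
Proof.
  split; [|split; [|split]].
  - intros y z. pose proof (hdist_coord y z 0 0). pose proof (Rabs_pos (val y 0%Z 0%nat - val z 0%Z 0%nat)).
    unfold weight in H. simpl in H. lra.
  - intros y z; split.
    + intro H. apply hull_ext. intros t r. pose proof (hdist_coord y z t r). rewrite H in H0.
      apply Rminus_diag_uniq. apply NNPP; intro Hne. apply Rabs_pos_lt in Hne. lra.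
    + intros <-. apply Rle_antisym.
      * apply hdist_uniform; [lra|]. intros t r. rewrite Rminus_diag, Rabs_R0. lra.
      * pose proof (hdist_coord y y 0 0). pose proof (Rabs_pos (val y 0%Z 0%nat - val y 0%Z 0%nat)).
        unfold weight in H. simpl in H. lra.
  - assert (H : forall y z, hdist y z <= hdist z y).
    { intros y z. apply hdist_le. intros t r. rewrite Rabs_minus_sym. apply hdist_coord. }
    intros y z; apply Rle_antisym; apply H.
  - intros x y z. apply hdist_le. intros t r.
    pose proof (hdist_coord x y t r). pose proof (hdist_coord y z t r).
    replace (val x t r - val z t r) with ((val x t r - val y t r) + (val y t r - val z t r)) by ring.
    eapply Rle_trans; [apply Rabs_triang|]. lra.
Qed.

Lemma hdist_refl y : hdist y y = 0.
Proof. now apply hdist_metric. Qed.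

(** Beyond [1/eps] the weight alone suffices, coordinates being in [[0,1]]. *)
Lemma hdist_window eps : 0 < eps -> exists L : Z, forall y z : hull,
  (forall t r, (Z.abs t <= L)%Z -> Rabs (val y t r - val z t r) <= eps) -> hdist y z <= eps.
Proof.
  intro He. exists (up (/ eps)). intros y z H. apply hdist_le. intros t r.
  pose proof (weight_ge1 t).
  destruct (Z_le_gt_dec (Z.abs t) (up (/ eps))) as [Ht|Ht].
  - specialize (H t r Ht). nra.
  - pose proof (hull_bounds y t r). pose proof (hull_bounds z t r).
    apply Rle_trans with 1; [apply Rabs_le; lra|].
    destruct (archimed (/ eps)) as [Ha _].
    assert (/ eps < weight t).
    { eapply Rlt_trans; [exact Ha|]. apply IZR_lt. lia. }
    apply Rmult_le_reg_l with (/ eps); [now apply Rinv_0_lt_compat|].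
    rewrite <- Rmult_assoc, Rinv_l by lra. lra.
Qed.

(** * The shift: transitivity and Li-Yorke pairs *)

Lemma shift_in_hull m y : in_hull y -> in_hull (fun t r => y (t + m)%Z r).
Proof.
  intros Hy L eps He. destruct (Hy (L + Z.abs m)%Z eps He) as (m' & Hm').
  exists (m' + m)%Z. intros t r Ht.
  replace (m' + m + t)%Z with (m' + (t + m))%Z by ring. apply Hm'. lia.
Qed.

Definition shift (m : Z) (y : hull) : hull := exist _ _ (shift_in_hull m (val y) (proj2_sig y)).

Lemma gen_in_hull : in_hull (gen n).
Proof.
  intros L eps He. exists 0%Z. intros t r _. rewrite Z.add_0_l, Rminus_diag, Rabs_R0. easy.
Qed.

Definition gen_pt : hull := exist _ _ gen_in_hull.

Lemma orbit_dense (y : hull) eps : 0 < eps -> exists m, hdist y (shift m gen_pt) < eps.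
Proof.
  intro He. destruct (hdist_window (eps / 2)) as (L & HL); [lra|].
  destruct (hull_near y L (eps / 2)) as (m & Hm); [lra|].
  exists m. apply Rle_lt_trans with (eps / 2); [|lra]. apply HL.
  intros t r Ht. apply Rlt_le. simpl. rewrite Z.add_comm. now apply Hm.
Qed.

Lemma iter_shift k y t r : val (iter_map hull (shift 1) k y) t r = val y (t + Z.of_nat k)%Z r.
Proof.
  revert t; induction k as [|k IH]; intro t.
  - simpl. f_equal. lia.
  - change (val (shift 1 (iter_map hull (shift 1) k y)) t r = val y (t + Z.of_nat (S k))%Z r).
    simpl. fold (val (iter_map hull (shift 1) k y)). rewrite IH. f_equal. lia.
Qed.

Lemma shift_continuous m : continuous_map hull hdist (shift m).
Proof.
  intros y eps He. pose proof (weight_ge1 m).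
  exists (eps / (2 * weight m)). split; [apply Rdiv_lt_0_compat; lra|]. intros z Hz.
  apply Rle_lt_trans with (eps / 2); [|lra]. apply hdist_le. intros t r. simpl.
  eapply Rle_trans; [apply hdist_coord|].
  assert (Hw : weight (t + m) <= weight t * weight m).
  { unfold weight. rewrite <- mult_IZR. apply IZR_le. nia. }
  pose proof (weight_ge1 (t + m)). pose proof (weight_ge1 t).
  apply Rle_trans with (eps / (2 * weight m) * (weight t * weight m)).
  - apply Rmult_le_compat; try lra. apply hdist_metric.
  - apply Req_le. field. lra.
Qed.

Lemma shift_homeomorphism : homeomorphism hull hdist (shift 1).
Proof.
  split; [apply shift_continuous|]. exists (shift (-1)). split; [apply shift_continuous|].
  split; intro y; apply hull_ext; intros t r; simpl; f_equal; lia.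
Qed.

Lemma hull_rigid eps (m : Z) : 0 < eps -> exists p, (m <= p)%Z /\
  forall (y : hull) t r, Rabs (val y (t + p)%Z r - val y t r) <= eps.
Proof.
  intro He. destruct (gen_rigid n eps m He) as (p & Hp & Hr).
  exists p; split; [easy|]. intros y t r. apply Rle_plus_epsilon. intros e Hpos.
  destruct (hull_near y (Z.abs t + Z.abs p) (e / 2)) as (m' & Hm'); [lra|].
  pose proof (Hm' t r ltac:(lia)) as H1. pose proof (Hm' (t + p)%Z r ltac:(lia)) as H2.
  specialize (Hr (m' + t)%Z r). rewrite <- Z.add_assoc in Hr.
  apply Rabs_def2 in H1. apply Rabs_def2 in H2.
  apply Rabs_le. pose proof (Rle_abs (gen n (m' + (t + p)) r - gen n (m' + t) r)).
  pose proof (Rle_abs (- (gen n (m' + (t + p)) r - gen n (m' + t) r))). rewrite Rabs_Ropp in *. lra.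
Qed.

(** Translates of the generator by [m1] and [m2] lie in [U] and [V]. The time [m2 - m1] may be
    negative; a large rigidity time [p] added to it makes it positive and moves the target only
    slightly. *)
Lemma hull_transitive : transitive_map hull hdist (shift 1).
Proof.
  intros U V HU HV [y Uy] [z Vz].
  assert (Hdense : forall W, Defs.open_set hull hdist W -> forall w, W w -> exists m, W (shift m gen_pt)).
  { intros W HW w Ww. destruct (HW w Ww) as (e & He & Hb). destruct (orbit_dense w e He) as (m & Hm). eauto. }
  destruct (Hdense U HU y Uy) as (m1 & H1). destruct (Hdense V HV z Vz) as (m2 & H2).
  destruct (HV _ H2) as (e & He & Hb).
  destruct (hull_rigid (e / 2) (m1 - m2 + 1)) as (p & Hp & Hr); [lra|].
  exists (Z.to_nat (m2 + p - m1)). split; [lia|].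
  exists (shift m1 gen_pt). split; [easy|]. apply Hb.
  apply Rle_lt_trans with (e / 2); [|lra]. apply hdist_uniform; [lra|]. intros t r.
  rewrite iter_shift, Rabs_minus_sym. simpl.
  replace (t + Z.of_nat (Z.to_nat (m2 + p - m1)) + m1)%Z with (t + m2 + p)%Z by lia.
  apply (Hr gen_pt).
Qed.

Lemma hull_proximal (x y : hull) : proximal hull hdist (shift 1) x y.
Proof.
  intros eps He N. destruct (hdist_window (eps / 2)) as (L & HL); [lra|].
  destruct (gen_gaps n L) as (M & HM & Hgap).
  (* The gap found for [x] is so wide that a gap of [y], which comes after a delay of at most [M],
     falls inside it. *)
  destruct (gen_gaps n (Z.abs L + M)) as (M' & HM' & Hgap').
  set (B := (Z.of_nat N + M' + M + Z.abs L)%Z).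
  destruct (hull_near x B (eps / 4)) as (mx & Hx); [lra|].
  destruct (hull_near y B (eps / 4)) as (my & Hy); [lra|].
  destruct (Hgap' (mx + Z.of_nat N)%Z) as (j & Hj & Hgx).
  destruct (Hgap (my + Z.of_nat N + j)%Z) as (j' & Hj' & Hgy).
  exists (Z.to_nat (Z.of_nat N + j + j')). split; [lia|].
  apply Rle_lt_trans with (eps / 2); [|lra]. apply HL. intros t r Ht.
  rewrite !iter_shift, Z2Nat.id by lia. set (k := (t + (Z.of_nat N + j + j'))%Z).
  assert (Hk : (Z.abs k <= B)%Z) by lia.
  pose proof (Hx k r Hk) as H1. pose proof (Hy k r Hk) as H2.
  replace (mx + k)%Z with (mx + Z.of_nat N + j + (j' + t))%Z in H1 by lia.
  replace (my + k)%Z with (my + Z.of_nat N + j + j' + t)%Z in H2 by lia.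
  rewrite Hgx in H1 by lia. rewrite Hgy in H2 by lia.
  apply Rabs_def2 in H1. apply Rabs_def2 in H2. apply Rabs_le. lra.
Qed.

(** At arbitrarily late rigidity times both points are back near their starting positions, so a
    coordinate in which they differ separates them again. *)
Lemma hull_not_asymptotic (x y : hull) : x <> y -> ~ asymptotic hull hdist (shift 1) x y.
Proof.
  intros Hxy Has.
  assert (exists t r, val x t r <> val y t r) as (t & r & Htr).
  { apply NNPP; intro H. apply Hxy, hull_ext. intros t r. apply NNPP; intro H'. eauto. }
  assert (Hpos : 0 < Rabs (val x t r - val y t r)) by (apply Rabs_pos_lt; lra).
  set (del := Rabs (val x t r - val y t r)) in *.
  pose proof (weight_ge1 t).
  destruct (Has (del / (4 * weight t))) as (N & HN); [apply Rdiv_lt_0_compat; lra|].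
  destruct (hull_rigid (del / 4) (Z.of_nat N)) as (p & Hp & Hr); [lra|].
  specialize (HN (Z.to_nat p) ltac:(lia)).
  pose proof (hdist_coord (iter_map hull (shift 1) (Z.to_nat p) x) (iter_map hull (shift 1) (Z.to_nat p) y) t r) as H1.
  rewrite !iter_shift, Z2Nat.id in H1 by lia.
  pose proof (Hr x t r) as H2. pose proof (Hr y t r) as H3.
  assert (Rabs (val x (t + p)%Z r - val y (t + p)%Z r) <= del / 4).
  { eapply Rle_trans; [exact H1|]. apply Rlt_le.
    apply Rlt_le_trans with (del / (4 * weight t) * weight t); [apply Rmult_lt_compat_r; lra|].
    apply Req_le; field; lra. }
  assert (del <= del / 4 + del / 4 + del / 4); [|lra].
  unfold del at 1.
  replace (val x t r - val y t r) with (- (val x (t + p)%Z r - val x t r) +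
    (val x (t + p)%Z r - val y (t + p)%Z r) + (val y (t + p)%Z r - val y t r)) by ring.
  eapply Rle_trans; [apply Rabs_triang|]. apply Rplus_le_compat; [|easy].
  eapply Rle_trans; [apply Rabs_triang|]. rewrite Rabs_Ropp. lra.
Qed.

(** * Scaling of coordinates and connectedness *)

Lemma scale_coord_in_hull r0 c y : (r0 < n)%nat -> 0 <= c <= 1 -> in_hull y ->
  in_hull (fun t r => (if Nat.eqb r r0 then c else 1) * y t r).
Proof.
  intros Hr0 Hc Hy L eps He.
  destruct (Hy L (eps / 2)) as (m & Hm); [lra|].
  (* The window grows by [|m|], because the scaled generator is read at the times [m + t]. *)
  destruct (gen_scaling n r0 c (eps / 2) (L + Z.abs m) Hr0 Hc) as (m' & Hm'); [lra|].
  exists (m' + m)%Z. intros t r Ht.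
  specialize (Hm t r Ht). specialize (Hm' (m + t)%Z r ltac:(lia)).
  rewrite Z.add_assoc in Hm'.
  set (s := if Nat.eqb r r0 then c else 1) in *.
  assert (0 <= s <= 1) by (unfold s; destruct Nat.eqb; lra).
  apply Rabs_def2 in Hm. apply Rabs_def2 in Hm'.
  apply Rabs_def1; nra.
Qed.

Lemma scale_in_hull (c : nat -> R) y : (forall r, 0 <= c r <= 1) -> in_hull y ->
  in_hull (fun t r => c r * y t r).
Proof.
  intros Hc Hy.
  assert (H : forall k, (k <= n)%nat -> in_hull (fun t r => (if Nat.ltb r k then c r else 1) * y t r)).
  { induction k as [|k IH]; intro Hk.
    - replace (fun t r => (if Nat.ltb r 0 then c r else 1) * y t r) with y; [easy|].
      extensionality t; extensionality r. simpl. ring.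
    - specialize (IH ltac:(lia)).
      apply (scale_coord_in_hull k (c k)) in IH; [|lia|easy].
      match type of IH with in_hull ?f => match goal with |- in_hull ?g => replace g with f; [easy|] end end.
      extensionality t; extensionality r.
      destruct (Nat.eqb_spec r k) as [->|]; destruct (Nat.ltb_spec r k) as [?|?] || idtac;
      repeat match goal with |- context [Nat.ltb ?a ?b] => destruct (Nat.ltb_spec a b) end; try lia; ring. }
  specialize (H n (Nat.le_refl n)).
  match type of H with in_hull ?f => match goal with |- in_hull ?g => replace g with f; [easy|] end end.
  extensionality t; extensionality r. destruct (Nat.ltb_spec r n); [easy|].
  pose proof (hull_out (exist _ y Hy) t r ltac:(easy)) as E. unfold val in E; simpl in E. rewrite E; ring.
Qed.

(** Clamping the factors makes scaling total in [c]. *)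
Definition scale (c : nat -> R) (y : hull) : hull :=
  exist _ _ (scale_in_hull (fun r => clamp (c r)) (val y) (fun r => clamp_bounds (c r)) (proj2_sig y)).

Lemma scale_dist (c c' : nat -> R) y e : 0 <= e -> (forall r, (r < n)%nat -> Rabs (c r - c' r) <= e) ->
  hdist (scale c y) (scale c' y) <= e.
Proof.
  intros He H. apply hdist_uniform; [easy|]. intros t r.
  change (Rabs (clamp (c r) * val y t r - clamp (c' r) * val y t r) <= e).
  destruct (Nat.lt_ge_cases r n) as [Hr|Hr].
  - rewrite <- Rmult_minus_distr_r, Rabs_mult.
    pose proof (hull_bounds y t r). rewrite (Rabs_right (val y t r)) by lra.
    assert (Rabs (clamp (c r) - clamp (c' r)) <= e).
    { eapply Rle_trans; [apply clamp_dist|]. now apply H. }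
    pose proof (Rabs_pos (clamp (c r) - clamp (c' r))). nra.
  - rewrite hull_out by easy. rewrite !Rmult_0_r, Rminus_diag, Rabs_R0. easy.
Qed.

(** The segments [scale (fun _ => s) y] join every point to the zero sequence. *)
Lemma hull_connected : connected_space hull hdist.
Proof.
  set (path := fun y s => scale (fun _ => s) y).
  assert (Hdist : forall y s s', hdist (path y s) (path y s') <= Rabs (s - s')).
  { intros y s s'. apply scale_dist; [apply Rabs_pos|]. intros; lra. }
  assert (H1 : forall y, path y 1 = y).
  { intro y. apply hull_ext. intros t r. change (clamp 1 * val y t r = val y t r).
    rewrite clamp_id by lra. ring. }
  assert (H0 : forall y z, path y 0 = path z 0).
  { intros y z. apply hull_ext. intros t r. change (clamp 0 * val y t r = clamp 0 * val z t r).
    rewrite clamp_id by lra. ring. }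
  assert (Main : forall U V : hull -> Prop, Defs.open_set hull hdist U -> Defs.open_set hull hdist V ->
    (forall x, U x \/ V x) -> (forall x, ~ (U x /\ V x)) -> forall y, V y -> U (path y 0) -> False).
  { intros U V HU HV Hcov Hdisj y Vy U0.
    (* The path starts in [U] and ends in [V]; at the supremum of [E] it can be in neither, both
       being open. *)
    set (E := fun s => 0 <= s <= 1 /\ U (path y s)).
    destruct (completeness E) as (s & Hub & Hlub).
    - exists 1. intros s [Hs _]; lra.
    - exists 0. split; [lra|easy].
    - assert (Hs0 : 0 <= s) by (apply Hub; split; [lra|easy]).
      assert (Hs1 : s <= 1) by (apply Hlub; intros v [Hv _]; lra).
      destruct (Hcov (path y s)) as [Us|Vs].
      + assert (s <> 1). { intros ->. rewrite H1 in Us. apply (Hdisj y); tauto. }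
        destruct (HU _ Us) as (e & He & Hb).
        set (s' := Rmin 1 (s + e / 2)).
        assert (s < s' <= s + e / 2 /\ s' <= 1).
        { unfold s', Rmin; destruct Rle_dec; lra. }
        assert (s' <= s); [|lra]. apply Hub. split; [lra|]. apply Hb.
        eapply Rle_lt_trans; [apply Hdist|]. apply Rabs_def1; lra.
      + destruct (HV _ Vs) as (e & He & Hb).
        assert (s <= s - e / 2); [|lra]. apply Hlub. intros v [Hv Uv].
        destruct (Rle_lt_dec v (s - e / 2)); [easy|]. exfalso.
        apply (Hdisj (path y v)); split; [easy|]. apply Hb.
        eapply Rle_lt_trans; [apply Hdist|].
        assert (v <= s) by (apply Hub; split; easy). apply Rabs_def1; lra. }
  intros (U & V & HU & HV & (x & Ux) & (y & Vy) & Hcov & Hdisj).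
  destruct (Hcov (path y 0)) as [H|H].
  - now apply (Main U V HU HV Hcov Hdisj y).
  - apply (Main V U HV HU) with x; try easy.
    + intro z. destruct (Hcov z); tauto.
    + intros z Hz. apply (Hdisj z); tauto.
    + now rewrite (H0 x y).
Qed.

(** * Compactness of the orbit closure *)

Lemma hull_complete : complete hull hdist.
Proof.
  intros u Hu.
  assert (Hc : forall t r i j, (i <= j)%nat -> Rabs (val (u i) t r - val (u j) t r) <= / INR (i + 1) * weight t).
  { intros t r i j Hij. eapply Rle_trans; [apply hdist_coord|]. pose proof (weight_ge1 t).
    apply Rmult_le_compat_r; [lra|]. now apply Hu. }
  assert (Hcauchy : forall t r, Cauchy_crit (fun i => val (u i) t r)).
  { intros t r eps He. pose proof (weight_ge1 t).
    destruct (inv_succ_small (eps / (2 * weight t))) as (N & HN); [apply Rdiv_lt_0_compat; lra|].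
    exists N. intros i j Hi Hj. unfold Rdist.
    assert (Hw : / INR (N + 1) * weight t < eps / 2).
    { apply Rlt_le_trans with (eps / (2 * weight t) * weight t); [apply Rmult_lt_compat_r; lra|].
      apply Req_le; field; lra. }
    pose proof (Hc t r N i ltac:(lia)) as H1. pose proof (Hc t r N j ltac:(lia)) as H2.
    replace (val (u i) t r - val (u j) t r) with
      (- (val (u N) t r - val (u i) t r) + (val (u N) t r - val (u j) t r)) by ring.
    eapply Rle_lt_trans; [apply Rabs_triang|]. rewrite Rabs_Ropp. lra. }
  set (y := fun t r => proj1_sig (R_complete _ (Hcauchy t r))).
  assert (Hy : forall t r i, Rabs (val (u i) t r - y t r) <= / INR (i + 1) * weight t).
  { intros t r i. unfold y; destruct R_complete as [l Hl]; simpl.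
    apply Rle_plus_epsilon. intros eps He. destruct (Hl eps He) as (N & HN).
    specialize (HN (Nat.max N i) ltac:(lia)). unfold Rdist in HN.
    pose proof (Hc t r i (Nat.max N i) ltac:(lia)).
    replace (val (u i) t r - l) with ((val (u i) t r - val (u (Nat.max N i)) t r) + (val (u (Nat.max N i)) t r - l)) by ring.
    eapply Rle_trans; [apply Rabs_triang|]. lra. }
  assert (Hyh : in_hull y).
  { intros L eps He. set (W := weight L). pose proof (weight_ge1 L). fold W in H.
    destruct (inv_succ_small (eps / (2 * W))) as (i & Hi); [apply Rdiv_lt_0_compat; lra|].
    destruct (hull_near (u i) L (eps / 2)) as (m & Hm); [lra|].
    exists m. intros t r Ht. specialize (Hm t r Ht).
    assert (Hd : Rabs (val (u i) t r - y t r) <= eps / 2).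
    { eapply Rle_trans; [apply Hy|].
      assert (weight t <= W) by (apply IZR_le; lia). pose proof (inv_succ_pos i). pose proof (weight_ge1 t).
      apply Rle_trans with (eps / (2 * W) * W); [apply Rmult_le_compat; lra|].
      apply Req_le; field; lra. }
    replace (y t r - gen n (m + t) r) with (- (val (u i) t r - y t r) + (val (u i) t r - gen n (m + t) r)) by ring.
    eapply Rle_lt_trans; [apply Rabs_triang|]. rewrite Rabs_Ropp. lra. }
  exists (exist _ y Hyh). intros eps He. destruct (inv_succ_small eps He) as (N & HN).
  exists N. intros i Hi. apply Rle_lt_trans with (/ INR (i + 1)).
  - apply hdist_le. intros t r. apply Hy.
  - eapply Rle_lt_trans; [|exact HN]. apply Rinv_le_contravar; [apply lt_0_INR; lia|apply le_INR; lia].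
Qed.

Lemma coordinate_cells (I : list (Z * nat)) eps : 0 < eps -> exists l : list (hull -> Prop),
  (forall x, exists A, In A l /\ A x) /\
  (forall A, In A l -> forall x y, A x -> A y -> forall t r, In (t, r) I -> Rabs (val x t r - val y t r) <= eps).
Proof.
  intro He. induction I as [|(t0, r0) I (l & Hl & Hdiam)].
  - exists ((fun _ => True) :: nil). split; [|easy]. intro x; exists (fun _ => True); simpl; tauto.
  - set (cell := fun (p : (hull -> Prop) * nat) x => fst p x /\
      INR (snd p) * eps <= val x t0 r0 <= (INR (snd p) + 1) * eps).
    exists (map cell (list_prod l (seq 0 (Z.to_nat (up (/ eps)) + 1)))). split.
    + intro x. destruct (Hl x) as (A & HA & Ax).
      pose proof (hull_bounds x t0 r0).
      pose (a := Int_part (val x t0 r0 / eps)).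
      destruct (base_Int_part (val x t0 r0 / eps)) as [H1 H2]. fold a in H1, H2.
      assert (Hv : 0 <= val x t0 r0 / eps <= / eps).
      { pose proof (Rinv_0_lt_compat eps He). unfold Rdiv. nra. }
      assert (Ha : (0 <= a)%Z). { assert (-1 < a)%Z; [apply lt_IZR; lra|lia]. }
      destruct (archimed (/ eps)) as [Hup _].
      assert (Ha' : (a < up (/ eps))%Z) by (apply lt_IZR; lra).
      exists (cell (A, Z.to_nat a)). split.
      * apply in_map, in_prod; [easy|]. apply in_seq. lia.
      * split; [easy|]. simpl snd. rewrite INR_IZR_INZ, Z2Nat.id by easy.
        replace (val x t0 r0) with (val x t0 r0 / eps * eps) by (field; lra).
        split; apply Rmult_le_compat_r; lra.
    + intros B HB x y Bx By t r Htr. apply in_map_iff in HB.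
      destruct HB as ((A & a) & <- & HAa). apply in_prod_iff in HAa.
      destruct Bx as [Ax Hx], By as [Ay Hy]. simpl in Ax, Ay, Hx, Hy.
      destruct Htr as [E|Htr]; [|now apply (Hdiam A)].
      injection E as <- <-. apply Rabs_le. lra.
Qed.

Lemma hull_totally_bounded : totally_bounded hull hdist.
Proof.
  intros eps He. destruct (hdist_window eps He) as (L & HL).
  destruct (coordinate_cells (list_prod (window L) (seq 0 n)) eps He) as (l & Hl & Hdiam).
  exists l. split; [easy|]. intros A HA x y Ax Ay. apply HL. intros t r Ht.
  destruct (Nat.lt_ge_cases r n).
  - apply (Hdiam A HA x y Ax Ay). apply in_prod; [apply in_window; lia|apply in_seq; lia].
  - rewrite !hull_out, Rminus_diag, Rabs_R0 by easy. lra.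
Qed.

Lemma hull_compact : compact_space hull hdist.
Proof.
  apply complete_totally_bounded_compact; [apply hdist_metric|apply hull_complete|apply hull_totally_bounded].
Qed.
End Hull.

(** * Dimension of the orbit closure *)

Definition wsum (I : list Z) (g : Z -> R) : R := fold_right (fun t a => g t + a) 0 I.

(** The multiplier is read off [g] itself instead of being quantified, which makes the condition a
    closed one, linear in [g]. *)
Definition on_ray (I : list Z) (b g : Z -> R) : Prop := forall t, In t I -> g t = wsum I g * b t.

Lemma wsum_scale I c g g' : (forall t, In t I -> g t = c * g' t) -> wsum I g = c * wsum I g'.
Proof.
  induction I as [|t I IH]; intro H; simpl; [ring|].
  rewrite IH, (H t) by (simpl; auto with datatypes). ring.
Qed.

Lemma wsum_close I e g g' : (forall t, In t I -> Rabs (g t - g' t) <= e) ->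
  Rabs (wsum I g - wsum I g') <= INR (length I) * e.
Proof.
  induction I as [|t I IH]; intro H.
  - simpl. rewrite Rminus_diag, Rabs_R0. lra.
  - change (wsum (t :: I) g) with (g t + wsum I g). change (wsum (t :: I) g') with (g' t + wsum I g').
    change (length (t :: I)) with (S (length I)). rewrite S_INR.
    replace (g t + wsum I g - (g' t + wsum I g')) with ((g t - g' t) + (wsum I g - wsum I g')) by ring.
    eapply Rle_trans; [apply Rabs_triang|].
    pose proof (H t (or_introl eq_refl)). pose proof (IH (fun s Hs => H s (or_intror Hs))). lra.
Qed.

Lemma wsum_nonneg I g : (forall t, 0 <= g t) -> 0 <= wsum I g.
Proof. intro H; induction I as [|t I IH]; simpl; [lra|]. specialize (H t). fold (wsum I g). lra. Qed.

Lemma wsum_ge I g t : (forall t, 0 <= g t) -> In t I -> g t <= wsum I g.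
Proof.
  intro H; induction I as [|s I IH]; simpl; [easy|]. fold (wsum I g).
  pose proof (wsum_nonneg I g H). pose proof (H s). intros [->|Ht]; [lra|]. specialize (IH Ht). lra.
Qed.

Lemma wsum_le I g : (forall t, g t <= 1) -> wsum I g <= INR (length I).
Proof.
  intro H; induction I as [|t I IH]; [simpl; lra|].
  change (wsum (t :: I) g) with (g t + wsum I g). change (length (t :: I)) with (S (length I)).
  rewrite S_INR. specialize (H t). lra.
Qed.

(* Used both to pass the ray structure from the orbit to its closure and to see that a ray is relatively open away from 0. *)
Lemma on_ray_isolated (I : list Z) (D : list (Z -> R)) (y : Z -> R) : exists delta, 0 < delta /\
  forall z, (forall t, In t I -> Rabs (y t - z t) <= delta) ->
  forall b, In b D -> on_ray I b z -> on_ray I b y.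
Proof.
  induction D as [|b0 D (d1 & Hd1 & H1)]; [exists 1; split; [lra|]; intros z _ b []|].
  assert (H0 : exists d0, 0 < d0 /\ forall z, (forall t, In t I -> Rabs (y t - z t) <= d0) ->
    on_ray I b0 z -> on_ray I b0 y).
  { destruct (classic (on_ray I b0 y)) as [Hy|Hy]; [exists 1; split; [lra|easy]|].
    assert (exists t, In t I /\ y t <> wsum I y * b0 t) as (t & Ht & Hne).
    { apply NNPP; intro H. apply Hy. intros t Ht. apply NNPP; intro H'. apply H; eauto. }
    set (e := Rabs (y t - wsum I y * b0 t)).
    assert (He : 0 < e) by (apply Rabs_pos_lt; lra).
    set (C := 1 + INR (length I) * Rabs (b0 t)).
    assert (HC : 1 <= C). { pose proof (pos_INR (length I)). pose proof (Rabs_pos (b0 t)). unfold C; nra. }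
    exists (e / (2 * C)). split; [apply Rdiv_lt_0_compat; lra|].
    intros z Hz Hray. exfalso.
    assert (Hle : e <= e / (2 * C) * C).
    { unfold e at 1. replace (y t - wsum I y * b0 t) with ((y t - z t) + (wsum I z - wsum I y) * b0 t)
        by (rewrite (Hray t Ht); ring).
      eapply Rle_trans; [apply Rabs_triang|]. rewrite Rabs_mult.
      pose proof (Hz t Ht). pose proof (wsum_close I _ _ _ Hz) as Hw. rewrite Rabs_minus_sym in Hw.
      pose proof (Rmult_le_compat_r _ _ _ (Rabs_pos (b0 t)) Hw). unfold C at 2. lra. }
    replace (e / (2 * C) * C) with (e / 2) in Hle by (field; lra). lra. }
  destruct H0 as (d0 & Hd0 & H0).
  exists (Rmin d0 d1). split; [now apply Rmin_pos|].
  intros z Hz b [<-|Hb].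
  - apply H0. intros t Ht. eapply Rle_trans; [now apply Hz|apply Rmin_l].
  - apply H1; [|easy]. intros t Ht. eapply Rle_trans; [now apply Hz|apply Rmin_r].
Qed.

Section Dimension.
Variable n : nat.
Notation hull := (hull n).
Notation val := (val n).
Notation hdist := (hdist n).

(** Up to nonnegative factors the generator has finitely many windows by [gen_windows], so its orbit
    sees finitely many rays; their union is closed and contains the windows of limits too. *)
Lemma hull_rays (L : Z) (r : nat) : exists D : list (Z -> R), forall y : hull,
  exists b, In b D /\ on_ray (window L) b (fun t => val y t r).
Proof.
  destruct (gen_windows n (Z.abs L)) as (K & HK).
  set (ray := fun s t => gen n (s + t) r / wsum (window L) (fun t => gen n (s + t) r)).
  assert (Hgen : forall m, exists b, In b (map ray (window K)) /\ on_ray (window L) b (fun t => gen n (m + t) r)).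
  { intro m. destruct (HK m) as (s & Hs & Hr). destruct (Hr r) as (c & Hc & Hct).
    exists (ray s). split; [apply in_map, in_window; lia|].
    assert (Hct' : forall t, In t (window L) -> gen n (m + t) r = c * gen n (s + t) r).
    { intros t Ht. apply in_window in Ht. now apply Hct. }
    intros t Ht. rewrite (wsum_scale _ _ _ _ Hct'), (Hct' t Ht). unfold ray.
    set (w := wsum _ _).
    assert (Hge : gen n (s + t) r <= w).
    { apply (wsum_ge (window L) (fun t => gen n (s + t) r)); [intro; apply gen_bounds|easy]. }
    pose proof (gen_bounds n (s + t) r).
    (* If the sum vanishes so does the window, and the division by 0 inside [ray] is harmless. *)
    destruct (Req_dec w 0) as [E|E].
    - replace (gen n (s + t) r) with 0 by lra. unfold Rdiv. ring.
    - field. easy. }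
  exists (map ray (window K)). intro y.
  destruct (on_ray_isolated (window L) (map ray (window K)) (fun t => val y t r)) as (e & He & Hiso).
  destruct (hull_near n y (Z.abs L) e He) as (m & Hm).
  destruct (Hgen m) as (b & Hb & Hray). exists b; split; [easy|].
  apply (Hiso (fun t => gen n (m + t) r)); [|easy|easy].
  intros t Ht. apply in_window in Ht. apply Rlt_le. now apply Hm.
Qed.

Definition offset (j : nat) : R := INR j / INR (n + 1).

Lemma offset_bounds j : (j <= n)%nat -> 0 <= offset j < 1.
Proof.
  intro Hj. assert (0 < INR (n + 1)) by (apply lt_0_INR; lia).
  assert (INR j < INR (n + 1)) by (apply lt_INR; lia). pose proof (pos_INR j).
  unfold offset. split.
  - apply Rmult_le_pos; [easy|]. now apply Rlt_le, Rinv_0_lt_compat.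
  - apply Rmult_lt_reg_r with (INR (n + 1)); [easy|].
    unfold Rdiv. rewrite Rmult_assoc, Rinv_l by lra. lra.
Qed.

Lemma IZR_unit_interval_unique x a a' : IZR a < x < IZR a + 1 -> IZR a' < x < IZR a' + 1 -> a = a'.
Proof.
  intros H H'. assert (a < a' + 1)%Z by (apply lt_IZR; rewrite plus_IZR; lra).
  assert (a' < a + 1)%Z by (apply lt_IZR; rewrite plus_IZR; lra). lia.
Qed.

(* Colour [j] cuts the finite union of rays seen by coordinate [r] at the lattice [offset j + Z] (scaled by [eta]); the [n + 1] lattices are disjoint, so a point is missed by at most one colour. *)
Lemma coordinate_colours (L : Z) (r : nat) eta : 0 < eta ->
  exists (fam : nat -> list (hull -> Prop)) (g : hull -> R),
    (forall j A, (j <= n)%nat -> In A (fam j) -> Defs.open_set hull hdist A /\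
       forall x y, A x -> A y -> forall t, In t (window L) -> Rabs (val x t r - val y t r) <= eta) /\
    (forall j A B x, (j <= n)%nat -> In A (fam j) -> In B (fam j) -> A x -> B x -> A = B) /\
    (forall j x, (j <= n)%nat -> (forall z, g x - offset j <> IZR z) -> exists A, In A (fam j) /\ A x).
Proof.
  intro Heta. destruct (hull_rays L r) as (D & HD).
  set (I := window L). set (h := fun y : hull => wsum I (fun t => val y t r)).
  assert (Hh : forall y, 0 <= h y <= INR (length I)).
  { intro y. split; [apply wsum_nonneg|apply wsum_le]; intro t; apply hull_bounds. }
  assert (Hval : forall (y : hull) t, In t I -> val y t r <= h y).
  { intros y t Ht. apply (wsum_ge I (fun t => val y t r)); [|easy]. intro; apply hull_bounds. }
  (* A nonnegative interval number keeps the piece away from 0, where different rays are apart.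
     Number -1 belongs to the piece around 0, which meets all rays, so no ray is prescribed
     there. *)
  set (piece := fun j (p : Z * (Z -> R)) (y : hull) =>
    IZR (fst p) < h y / eta - offset j < IZR (fst p) + 1 /\
    ((0 <= fst p)%Z -> on_ray I (snd p) (fun t => val y t r))).
  set (N := up (INR (length I) / eta)).
  (* Since [offset j < 1] and [h y >= 0], interval numbers start at -1. *)
  set (cells := (-1)%Z :: window N).
  assert (Hpos : forall j p y, (j <= n)%nat -> piece j p y -> (0 <= fst p)%Z -> 0 < h y).
  { intros j p y Hj [Hp _] Hp0. apply IZR_le in Hp0. pose proof (offset_bounds j Hj).
    replace (h y) with (h y / eta * eta) by (field; lra). apply Rmult_lt_0_compat; lra. }
  assert (Hcells : forall a, (-1 <= a)%Z -> IZR a <= INR (length I) / eta -> In a cells).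
  { intros a Ha Ha'. destruct (Z.eq_dec a (-1)) as [->|]; [now left|]. right. apply in_window.
    destruct (archimed (INR (length I) / eta)) as [Hup _]. fold N in Hup.
    assert (a < N)%Z by (apply lt_IZR; lra). lia. }
  assert (Hclose : forall x e, 0 < e -> exists del, 0 < del /\ forall y, hdist x y < del ->
      (forall t, In t I -> Rabs (val x t r - val y t r) <= e) /\ Rabs (h y / eta - h x / eta) < e).
  { intros x e He.
    set (W := weight L). pose proof (weight_ge1 L) as HW. fold W in HW.
    set (C := INR (length I) / eta + 1).
    assert (HC : 1 <= C).
    { unfold C. pose proof (pos_INR (length I)). pose proof (Rinv_0_lt_compat eta Heta). unfold Rdiv. nra. }
    exists (e / (C * W)).
    assert (0 < C * W) by nra. split; [now apply Rdiv_lt_0_compat|]. intros y Hy.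
    assert (Hc : forall t, In t I -> Rabs (val x t r - val y t r) <= e / C).
    { intros t Ht. apply in_window in Ht. eapply Rle_trans; [apply hdist_coord|].
      assert (weight t <= W) by (apply IZR_le; lia). pose proof (weight_ge1 t).
      assert (0 <= hdist x y) by apply hdist_metric.
      apply Rle_trans with (e / (C * W) * W); [apply Rmult_le_compat; lra|].
      apply Req_le; field; lra. }
    assert (HeC : 0 < e / C) by (apply Rdiv_lt_0_compat; lra).
    assert (HCe : C * (e / C) = e) by (field; lra).
    split.
    - intros t Ht. eapply Rle_trans; [now apply Hc|]. nra.
    - pose proof (wsum_close I _ _ _ Hc) as Hw. fold (h x) (h y) in Hw.
      replace (h y / eta - h x / eta) with (- ((h x - h y) * / eta)) by (field; lra).
      pose proof (Rinv_0_lt_compat eta Heta).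
      rewrite Rabs_Ropp, Rabs_mult, (Rabs_right (/ eta)) by lra.
      apply Rle_lt_trans with (INR (length I) * (e / C) * / eta); [apply Rmult_le_compat_r; lra|].
      replace (INR (length I) * (e / C) * / eta) with ((C - 1) * (e / C)) by (unfold C at 1, Rdiv; field; lra).
      lra. }
  exists (fun j => map (piece j) (list_prod cells D)), (fun y => h y / eta).
  split; [|split].
  - intros j A Hj HA. apply in_map_iff in HA. destruct HA as ((a & b) & <- & Hab).
    apply in_prod_iff in Hab. destruct Hab as [Ha Hb]. split.
    + intros x [Hx Hxb]. simpl in Hx, Hxb.
      destruct (on_ray_isolated I D (fun t => val x t r)) as (e1 & He1 & Hiso).
      set (e := Rmin e1 (Rmin (h x / eta - offset j - IZR a) (IZR a + 1 - (h x / eta - offset j)))).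
      assert (He : 0 < e /\ e <= e1 /\ e <= h x / eta - offset j - IZR a /\ e <= IZR a + 1 - (h x / eta - offset j)).
      { unfold e, Rmin. repeat destruct Rle_dec; lra. }
      destruct (Hclose x e) as (del & Hdel & Hb'); [lra|].
      exists del; split; [easy|]. intros y Hy. destruct (Hb' y Hy) as [Hc Hhc].
      apply Rabs_def2 in Hhc. split; [simpl; lra|]. simpl. intro Ha0.
      (* A ray [b'] through the nearby point [y] also contains [x] by isolation. As [h x > 0], it
         agrees with [b] on the window, hence [y] is on the ray [b]. *)
      destruct (HD y) as (b' & Hb'D & Hray).
      assert (Hray' : on_ray I b' (fun t => val x t r)).
      { apply (Hiso (fun t => val y t r)); [|easy|easy]. intros t Ht. eapply Rle_trans; [now apply Hc|lra]. }
      assert (Hxpos : 0 < h x) by (apply (Hpos j (a, b)); [easy|split; easy|easy]).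
      intros t Ht. rewrite (Hray t Ht). f_equal.
      apply Rmult_eq_reg_l with (h x); [|lra]. unfold h at 1. rewrite <- (Hray' t Ht). now apply Hxb.
    + intros x y Ax Ay t Ht.
      pose proof (hull_bounds n x t r). pose proof (hull_bounds n y t r).
      pose proof (Hval x t Ht). pose proof (Hval y t Ht).
      destruct (Z_le_gt_dec 0 a) as [Ha0|Ha0].
      * pose proof (Hpos _ _ x Hj Ax Ha0) as Hxp.
        destruct Ax as [Hx Hxb], Ay as [Hy Hyb]. simpl in Hx, Hxb, Hy, Hyb.
        pose proof (Hxb Ha0 t Ht) as E1. pose proof (Hyb Ha0 t Ht) as E2. cbv beta in E1, E2.
        fold (h x) in E1. fold (h y) in E2.
        assert (Hb01 : 0 <= b t <= 1).
        { split; apply Rmult_le_reg_l with (h x); lra. }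
        rewrite E1, E2, <- Rmult_minus_distr_r, Rabs_mult, (Rabs_right (b t)) by lra.
        assert (Hdiff : Rabs (h x - h y) <= eta).
        { replace (h x - h y) with ((h x / eta - h y / eta) * eta) by (field; lra).
          rewrite Rabs_mult, (Rabs_right eta) by lra.
          apply Rle_trans with (1 * eta); [|lra]. apply Rmult_le_compat_r; [lra|]. apply Rabs_le; lra. }
        pose proof (Rabs_pos (h x - h y)). nra.
      * assert (Hsmall : forall z, piece j (a, b) z -> h z <= eta).
        { intros z [Hz _]. simpl in Hz. pose proof (offset_bounds j Hj).
          assert (IZR a <= -1) by (apply IZR_le; lia).
          replace (h z) with (h z / eta * eta) by (field; lra).
          apply Rle_trans with (1 * eta); [|lra]. apply Rmult_le_compat_r; lra. }
        pose proof (Hsmall x Ax). pose proof (Hsmall y Ay). apply Rabs_le; lra.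
  - intros j A B x Hj HA HB Ax Bx.
    apply in_map_iff in HA. destruct HA as ((a & b) & <- & _).
    apply in_map_iff in HB. destruct HB as ((a' & b') & <- & _).
    assert (a = a') as <-.
    { apply IZR_unit_interval_unique with (h x / eta - offset j); [apply Ax|apply Bx]. }
    (* Directions [b] and [b'] may differ off the window, but sharing a nonzero point they agree on
       it, and the two pieces are the same set. *)
    destruct (Z_le_gt_dec 0 a) as [Ha0|Ha0].
    + pose proof (Hpos _ _ x Hj Ax Ha0) as Hxp.
      assert (Hbb : forall t, In t I -> b t = b' t).
      { intros t Ht. apply Rmult_eq_reg_l with (h x); [|lra].
        pose proof (proj2 Ax Ha0 t Ht) as E1. pose proof (proj2 Bx Ha0 t Ht) as E2.
        simpl in E1, E2. fold (h x) in E1, E2. lra. }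
      extensionality z. apply propositional_extensionality.
      split; intros [Hz Hzb]; (split; [exact Hz|]); intros _ t Ht; simpl in *; rewrite (Hzb Ha0 t Ht);
        now rewrite Hbb.
    + extensionality z. apply propositional_extensionality.
      split; intros [Hz _]; (split; [exact Hz|]); simpl; lia.
  - intros j x Hj Hz. destruct (HD x) as (b & Hb & Hray).
    set (u := h x / eta - offset j) in *.
    destruct (base_Int_part u) as [Hu1 Hu2]. set (a := Int_part u) in *.
    pose proof (offset_bounds j Hj) as Ho. destruct (Hh x) as [Hx0 Hx1].
    assert (Hux : - 1 < u <= INR (length I) / eta).
    { pose proof (Rinv_0_lt_compat eta Heta). unfold u, Rdiv. nra. }
    exists (piece j (a, b)). split.
    + apply in_map, in_prod; [|easy]. apply Hcells; [|lra].
      assert (-2 < a)%Z by (apply lt_IZR; lra). lia.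
    + split; simpl; [|easy]. fold u. specialize (Hz a). lra.
Qed.

(** Pieces of equal colour are intersected across the first [k] coordinates, so a colour catches a
    point when it does so in each of them. *)
Lemma hull_colours (L : Z) eta k : 0 < eta ->
  exists (fam : nat -> list (hull -> Prop)) (g : nat -> hull -> R),
    (forall j A, (j <= n)%nat -> In A (fam j) -> Defs.open_set hull hdist A /\
       forall x y, A x -> A y -> forall t r, In t (window L) -> (r < k)%nat -> Rabs (val x t r - val y t r) <= eta) /\
    (forall j A B x, (j <= n)%nat -> In A (fam j) -> In B (fam j) -> A x -> B x -> A = B) /\
    (forall j x, (j <= n)%nat -> (forall r z, (r < k)%nat -> g r x - offset j <> IZR z) ->
       exists A, In A (fam j) /\ A x).
Proof.
  intro Heta. induction k as [|k (fam & g & H1 & H2 & H3)].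
  - exists (fun _ => (fun _ => True) :: nil), (fun _ _ => 0). split; [|split].
    + intros j A _ [<-|[]]. split; [|intros; lia]. intros x _. exists 1; split; [lra|easy].
    + intros j A B x _ [<-|[]] [<-|[]]; easy.
    + intros j x _ _. exists (fun _ => True). simpl; tauto.
  - destruct (coordinate_colours L k eta Heta) as (fam' & g' & H1' & H2' & H3').
    set (inter := fun (p : (hull -> Prop) * (hull -> Prop)) x => fst p x /\ snd p x).
    exists (fun j => map inter (list_prod (fam j) (fam' j))),
      (fun r => if Nat.eqb r k then g' else g r).
    split; [|split].
    + intros j C Hj HC. apply in_map_iff in HC. destruct HC as ((A & B) & <- & HAB).
      apply in_prod_iff in HAB. destruct HAB as [HA HB].
      destruct (H1 j A Hj HA) as [HAo HAd]. destruct (H1' j B Hj HB) as [HBo HBd]. split.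
      * intros x [Ax Bx]. destruct (HAo x Ax) as (e1 & He1 & Hb1). destruct (HBo x Bx) as (e2 & He2 & Hb2).
        exists (Rmin e1 e2). split; [now apply Rmin_pos|]. intros y Hy.
        split; [apply Hb1|apply Hb2]; (eapply Rlt_le_trans; [exact Hy|]); [apply Rmin_l|apply Rmin_r].
      * intros x y [Ax Bx] [Ay By] t r Ht Hr.
        destruct (Nat.eq_dec r k) as [->|]; [now apply HBd|]. apply HAd; try easy. lia.
    + intros j C C' x Hj HC HC' Cx Cx'.
      apply in_map_iff in HC. destruct HC as ((A & B) & <- & HAB).
      apply in_map_iff in HC'. destruct HC' as ((A' & B') & <- & HAB').
      apply in_prod_iff in HAB, HAB'. destruct Cx as [Ax Bx], Cx' as [Ax' Bx'].
      f_equal. f_equal; [apply (H2 j) with x|apply (H2' j) with x]; tauto.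
    + intros j x Hj Hint.
      destruct (H3 j x Hj) as (A & HA & Ax).
      { intros r z Hr. specialize (Hint r z ltac:(lia)). destruct (Nat.eqb_spec r k); [lia|easy]. }
      destruct (H3' j x Hj) as (B & HB & Bx).
      { intro z. specialize (Hint k z ltac:(lia)). now rewrite Nat.eqb_refl in Hint. }
      exists (inter (A, B)). split; [|easy]. now apply in_map, in_prod.
Qed.

Lemma offset_lattices_disjoint (u : R) (z z' : Z) j j' : (j <= n)%nat -> (j' <= n)%nat ->
  u - offset j = IZR z -> u - offset j' = IZR z' -> j = j'.
Proof.
  intros Hj Hj' E E'. pose proof (offset_bounds j Hj). pose proof (offset_bounds j' Hj').
  assert (z < z' + 1)%Z by (apply lt_IZR; rewrite plus_IZR; lra).
  assert (z' < z + 1)%Z by (apply lt_IZR; rewrite plus_IZR; lra).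
  assert (z = z') as <- by lia.
  assert (HE : offset j = offset j') by lra. unfold offset in HE.
  assert (0 < INR (n + 1)) by (apply lt_0_INR; lia).
  apply INR_eq. apply Rmult_eq_reg_r with (/ INR (n + 1)); [easy|].
  apply Rgt_not_eq, Rinv_0_lt_compat; easy.
Qed.

(** If all [n + 1] colours missed [x], each would do so in one of [n] coordinates; two colours would
    share a coordinate, against the disjointness of their lattices. *)
Lemma hull_dim_le : covering_dim_le hull hdist n.
Proof.
  apply coloured_dim_le; [apply hdist_metric|exact (inhabits (gen_pt n))|apply hull_compact|].
  intros eps He. destruct (hdist_window n (eps / 2)) as (L & HL); [lra|].
  destruct (hull_colours L (eps / 2) n) as (fam & g & H1 & H2 & H3); [lra|].
  exists fam. split; [|split; [easy|]].
  - intros j A Hj HA. destruct (H1 j A Hj HA) as [Hop Hd]. split; [easy|].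
    intros x y Ax Ay. apply Rle_lt_trans with (eps / 2); [|lra]. apply HL. intros t r Ht.
    destruct (Nat.lt_ge_cases r n).
    + apply Hd; try easy. apply in_window. lia.
    + rewrite !hull_out, Rminus_diag, Rabs_R0 by easy. lra.
  - intro x. apply NNPP; intro Hno.
    assert (Hbad : forall j, exists r, (j <= n)%nat -> (r < n)%nat /\ exists z, g r x - offset j = IZR z).
    { intro j. destruct (le_dec j n) as [Hj|]; [|exists 0%nat; lia].
      apply NNPP; intro H. apply Hno. destruct (H3 j x Hj) as (A & HA & Ax); [|eauto].
      intros r z Hr E. apply H. exists r. intros _. eauto. }
    destruct (functional_choice _ Hbad) as (rho & Hrho).
    assert (Hlen : (length (map rho (seq 0 (n + 1))) <= length (seq 0 n))%nat).
    { apply NoDup_incl_length.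
      - apply NoDup_map_NoDup_ForallPairs; [|apply seq_NoDup].
        intros j j' Hj Hj' E. apply in_seq in Hj, Hj'.
        destruct (Hrho j ltac:(lia)) as (_ & z & Hz). destruct (Hrho j' ltac:(lia)) as (_ & z' & Hz').
        rewrite E in Hz. apply (offset_lattices_disjoint (g (rho j') x) z z'); try easy; lia.
      - intros r Hr. apply in_map_iff in Hr. destruct Hr as (j & <- & Hj). apply in_seq in Hj.
        destruct (Hrho j ltac:(lia)) as [Hr _]. apply in_seq. lia. }
    rewrite length_map, !length_seq in Hlen. lia.
Qed.

(** * Lower bound for the dimension *)

Definition cube (c : nat -> R) : hull := scale n c (gen_pt n).

Lemma cube_val c r : (r < n)%nat -> val (cube c) 0 r = clamp (c r).
Proof.
  intro Hr. change (clamp (c r) * gen n 0 r = clamp (c r)). rewrite gen_0 by easy. ring.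
Qed.

Lemma coord_open (P : R -> Prop) r : (forall v, P v -> exists e, 0 < e /\ forall w, Rabs (v - w) < e -> P w) ->
  Defs.open_set hull hdist (fun y => P (val y 0 r)).
Proof.
  intros HP y Py. destruct (HP _ Py) as (e & He & H). exists e; split; [easy|].
  intros z Hz. apply H. eapply Rle_lt_trans; [apply hdist_coord|].
  unfold weight; simpl. lra.
Qed.

(* The sets of this cover restrict to Kuhn's labelling conditions on the cube: the i-th one avoids the faces [c r = 0], [r < i], and [c i = 1]. *)
Definition kuhn_cover (i : nat) (y : hull) : Prop :=
  (forall r, (r < i)%nat -> 1 / 3 < val y 0 r) /\ ((i < n)%nat -> val y 0 i < 2 / 3).

Lemma kuhn_cover_open_cover : finite_open_cover hull hdist (n + 1) kuhn_cover.
Proof.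
  assert (Hlow : forall i, Defs.open_set hull hdist (fun y => forall r, (r < i)%nat -> 1 / 3 < val y 0 r)).
  { induction i as [|i IH]; intros y Hy; [exists 1; split; [lra|intros; lia]|].
    destruct (IH y) as (e1 & He1 & H1); [intros r Hr; apply Hy; lia|].
    destruct (coord_open (fun v => 1 / 3 < v) i) with y as (e2 & He2 & H2); [|apply Hy; lia|].
    { intros v Hv. exists (v - 1 / 3); split; [lra|]. intros w Hw. apply Rabs_def2 in Hw. lra. }
    exists (Rmin e1 e2); split; [now apply Rmin_pos|]. intros z Hz r Hr.
    pose proof (Rmin_l e1 e2). pose proof (Rmin_r e1 e2).
    destruct (Nat.eq_dec r i) as [->|]; [apply H2|apply H1]; try lra; lia. }
  split.
  - intros i Hi y [Hy1 Hy2]. destruct (Hlow i y Hy1) as (e1 & He1 & H1).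
    destruct (Nat.lt_ge_cases i n) as [Hin|Hin].
    + destruct (coord_open (fun v => v < 2 / 3) i) with y as (e2 & He2 & H2); [|now apply Hy2|].
      { intros v Hv. exists (2 / 3 - v); split; [lra|]. intros w Hw. apply Rabs_def2 in Hw. lra. }
      exists (Rmin e1 e2); split; [now apply Rmin_pos|]. intros z Hz.
      pose proof (Rmin_l e1 e2). pose proof (Rmin_r e1 e2).
      split; [apply H1; lra|intros _; apply H2; lra].
    + exists e1; split; [easy|]. intros z Hz. split; [now apply H1|lia].
  - intro y. assert (H : forall m, (m <= n)%nat -> (exists i, (i < n + 1)%nat /\ kuhn_cover i y) \/
      forall r, (r < m)%nat -> 1 / 3 < val y 0 r).
    { induction m as [|m IH]; intro Hm; [right; lia|].
      destruct (IH ltac:(lia)) as [H|H]; [now left|].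
      destruct (Rlt_le_dec (1 / 3) (val y 0%Z m)) as [Hlt|Hle].
      - right. intros r Hr. destruct (Nat.eq_dec r m) as [->|]; [easy|]. apply H. lia.
      - left. exists m. split; [lia|]. split; [easy|]. intros _. lra. }
    destruct (H n (Nat.le_refl n)) as [H'|H']; [easy|].
    exists n. split; [lia|]. split; [easy|lia].
Qed.

(** Each grid point of the cube is labelled through a set of the refinement that contains its
    [delta]-ball. Kuhn's lemma finds a cell with all [n + 1] labels, hence [n + 1] different sets
    with a common point. *)
Lemma hull_dim_gt : (1 <= n)%nat -> ~ covering_dim_le hull hdist (n - 1).
Proof.
  intros Hn Hdim.
  destruct (Hdim _ _ kuhn_cover_open_cover) as (k & V & HV & Href & Hord).
  destruct (lebesgue_number _ _ (hdist_metric n) k V (hull_compact n) HV) as (delta & Hdelta & HLeb).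
  destruct (functional_choice _ HLeb) as (idx & Hidx).
  assert (Hcol : forall j, exists i, (j < k)%nat -> (i < n + 1)%nat /\ forall x, V j x -> kuhn_cover i x).
  { intro j. destruct (lt_dec j k) as [Hj|]; [|exists 0%nat; lia].
    destruct (Href j Hj) as (i & Hi). now exists i. }
  destruct (functional_choice _ Hcol) as (col & Hcolour).
  (* Kuhn's coordinates run from 0 to [S N], so the mesh is [1/(N+1)], below the Lebesgue number. *)
  destruct (inv_succ_small delta Hdelta) as (N & HN).
  set (pt := fun x : nat -> nat => cube (fun r => INR (x r) / INR (N + 1))).
  set (lab := fun x => col (idx (pt x))).
  assert (HN0 : 0 < INR (N + 1)) by (apply lt_0_INR; lia).
  assert (Hlab : forall x, (lab x < n + 1)%nat /\ kuhn_cover (lab x) (pt x)).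
  { intro x. destruct (Hidx (pt x)) as [Hk Hball]. destruct (Hcolour _ Hk) as [Hc1 Hc2].
    split; [easy|]. apply Hc2, Hball. rewrite hdist_refl. easy. }
  destruct (@Kuhn.kuhn_nat n N lab) as (v & Hv).
  { intros x Hx Hx0. destruct (Hlab x) as [Hl [Hlo Hhi]]. split; [lia|split].
    - intros r Hr E. destruct (le_lt_dec (lab x) r) as [|Hlt]; [easy|]. exfalso.
      specialize (Hlo r Hlt). unfold pt in Hlo. rewrite cube_val, E in Hlo by easy.
      replace (INR 0 / INR (N + 1)) with 0 in Hlo by (simpl; field; lra).
      rewrite clamp_id in Hlo by lra. lra.
    - intros r Hr E Hlr. rewrite Hlr in Hhi. specialize (Hhi Hr).
      unfold pt in Hhi. rewrite cube_val, E in Hhi by easy.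
      replace (INR (S N) / INR (N + 1)) with 1 in Hhi by (rewrite <- Nat.add_1_r; field; lra).
      rewrite clamp_id in Hhi by lra. lra. }
  assert (Hv' : forall i, exists x, (i <= n)%nat -> lab x = i /\
    forall r, (r < n)%nat -> (v r <= x r <= S (v r))%nat).
  { intro i. destruct (le_dec i n) as [Hi|]; [|exists (fun _ => 0%nat); lia].
    destruct (Hv i Hi) as (x & Hx1 & _ & _ & Hx2). exists x. intros _. split; [easy|].
    intros r Hr. specialize (Hx2 r Hr). lia. }
  destruct (functional_choice _ Hv') as (q & Hq).
  set (l := map (fun i => idx (pt (q i))) (seq 0 (n + 1))).
  assert (Hlen : (length l <= n - 1 + 1)%nat).
  { apply (Hord (pt (q 0%nat))).
    - apply NoDup_map_NoDup_ForallPairs; [|apply seq_NoDup].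
      intros i i' Hi Hi' E. apply in_seq in Hi, Hi'.
      destruct (Hq i ltac:(lia)) as [<- _]. destruct (Hq i' ltac:(lia)) as [<- _].
      unfold lab. now rewrite E.
    - intros j Hj. apply in_map_iff in Hj. destruct Hj as (i & <- & Hi). apply in_seq in Hi.
      destruct (Hidx (pt (q i))) as [Hk Hball]. split; [easy|]. apply Hball.
      eapply Rle_lt_trans; [|exact HN]. apply scale_dist; [apply Rlt_le; apply Rinv_0_lt_compat; easy|].
      intros r Hr. destruct (Hq i ltac:(lia)) as [_ H1]. destruct (Hq 0%nat ltac:(lia)) as [_ H2].
      specialize (H1 r Hr). specialize (H2 r Hr).
      unfold Rdiv. rewrite <- Rmult_minus_distr_r, Rabs_mult.
      rewrite (Rabs_right (/ _)) by (apply Rle_ge, Rlt_le, Rinv_0_lt_compat; easy).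
      rewrite <- (Rmult_1_l (/ INR (N + 1))) at 2.
      apply Rmult_le_compat_r; [apply Rlt_le, Rinv_0_lt_compat; easy|].
      apply Rabs_le. rewrite !INR_IZR_INZ, <- minus_IZR. split; [apply (IZR_le (-1))|apply (IZR_le _ 1)]; lia. }
  unfold l in Hlen. rewrite length_map, length_seq in Hlen. lia.
Qed.
End Dimension.

Theorem mainTheorem3 :
  forall n : nat, (1 <= n)%nat ->
    exists (Y : Type) (d : Y -> Y -> R) (S : Y -> Y),
      continuum Y d /\ covering_dim_eq Y d n /\
      homeomorphism Y d S /\ transitive_map Y d S /\
      completely_scrambled Y d S.
Proof.
  intros n Hn. exists (hull n), (hdist n), (shift n 1).
  split; [|split; [|split; [|split]]].
  - split; [apply hdist_metric|split; [exact (inhabits (gen_pt n))|split]].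
    + apply hull_compact.
    + apply hull_connected.
  - split; [apply hull_dim_le|now apply hull_dim_gt].
  - apply shift_homeomorphism.
  - apply hull_transitive.
  - intros x y Hxy. split; [apply hull_proximal|now apply hull_not_asymptotic].
Qed.
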